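(* Let $(\Omega,\beta,\mu)$ be a finite measure space. Let $X$ be a separable Banach space which is the dual of a separable Banach space, and let $(F_s)_{s\in\mathbb{R}}$ be an increasing family of sub-$\sigma$-algebras of $\beta$ with $F_s\uparrow F_\infty$ as $s\to\infty$. Then for any $f\in L_1(\Omega,X)$, $$\lim_{s\to\infty}E(f|F_s)=E(f|F_\infty)$$ almost everywhere on $\Omega$ (convergence in the norm of $X$).
   Context: $L_1(\Omega,X)$ is the Banach space of $X$-valued Bochner integrable functions $f$ on $\Omega$ with norm $\|f\|_1=\int_\Omega\|f(\omega)\|_X\,d\mu$. For a sub-$\sigma$-algebra $F\subset\beta$, $E(\cdot|F):L_1(\Omega,X)\to L_1(\Omega,X)$ is the (Bochner) conditional expectation operator: $E(f|F)$ is $F$-measurable and $\int_B E(f|F)\,d\mu=\int_B f\,d\mu$ for all $B\in F$. The notation $F_s\uparrow F_\infty$ means that $F_{s_1}\subset F_{s_2}$ for $s_1<s_2$ and $F_\infty$ is the $\sigma$-algebra generated by $\bigcup_s F_s$. *)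

(* Defs.v *)
From HB Require Import structures.
From mathcomp Require Import all_boot all_order all_algebra.
From mathcomp Require Import all_classical all_reals all_analysis.

Set Implicit Arguments.
Unset Strict Implicit.
Unset Printing Implicit Defensive.

Import Order.TTheory GRing.Theory Num.Theory.
Import numFieldNormedType.Exports.

Local Open Scope classical_set_scope.
Local Open Scope ring_scope.

Definition separable (T : topologicalType) : Prop :=
  exists2 D : set T, countable D & dense D.

(* X is isometrically isomorphic, via J, to the space of continuous linear
   functionals on Y with the operator norm. *)
Definition is_dual_of (R : realType) (X Y : normedModType R) : Prop :=
  exists J : X -> {linear Y -> R^o},
    [/\ (forall x, continuous (J x)),
        (forall (a : R) (x x' : X) (y : Y),
           J (a *: x + x') y = a * J x y + J x' y),
        (forall phi : {linear Y -> R^o}, continuous phi ->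
           exists x, forall y, J x y = phi y)
      & (forall x, `|x| = sup [set `|J x y| | y in [set y : Y | `|y| <= 1]])].

(* A sub-sigma-algebra of the ambient one is a set system G : set (set T). *)
Definition is_sub_sigma_algebra (d : measure_display) (T : measurableType d)
    (G : set (set T)) : Prop :=
  sigma_algebra setT G /\ G `<=` measurable.

Definition simple_wrt (R : realType) (T : Type) (X : normedModType R)
    (G : set (set T)) (s : T -> X) : Prop :=
  finite_set (range s) /\ forall x, G (s @^-1` [set x]).

Definition strongly_measurable_wrt (R : realType) (T : Type)
    (X : normedModType R) (G : set (set T)) (f : T -> X) : Prop :=
  exists2 s : nat -> T -> X, (forall n, simple_wrt G (s n)) &
    forall w, s n w @[n --> \oo] --> f w.

Definition bochner_integrable (d : measure_display) (T : measurableType d)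
    (R : realType) (mu : {finite_measure set T -> \bar R})
    (X : normedModType R) (f : T -> X) : Prop :=
  strongly_measurable_wrt measurable f /\
  (\int[mu]_w (`|f w|%:E) < +oo)%E.

Definition simple_integral (d : measure_display) (T : measurableType d)
    (R : realType) (mu : {finite_measure set T -> \bar R})
    (X : normedModType R) (D : set T) (s : T -> X) : X :=
  \sum_(x \in range s) fine (mu (D `&` s @^-1` [set x])) *: x.

Definition is_bochner_integral (d : measure_display) (T : measurableType d)
    (R : realType) (mu : {finite_measure set T -> \bar R})
    (X : normedModType R) (D : set T) (f : T -> X) (v : X) : Prop :=
  exists s : nat -> T -> X,
    [/\ (forall n, simple_wrt measurable (s n)),
        (\int[mu]_(w in D) (`|f w - s n w|%:E))%E @[n --> \oo] --> 0%E
      & simple_integral mu D (s n) @[n --> \oo] --> v].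

(* Meaningful when f is Bochner integrable and D is measurable; 0 when no
   value satisfies is_bochner_integral. *)
Definition bochner_integral (d : measure_display) (T : measurableType d)
    (R : realType) (mu : {finite_measure set T -> \bar R})
    (X : normedModType R) (D : set T) (f : T -> X) : X :=
  xget 0 [set v | is_bochner_integral mu D f v].

(* g is a version of E(f | G): elements of L_1 are represented by functions,
   so that E(f | G) is determined only up to mu-almost everywhere equality. *)
Definition is_cond_exp (d : measure_display) (T : measurableType d)
    (R : realType) (mu : {finite_measure set T -> \bar R})
    (X : normedModType R) (G : set (set T)) (f g : T -> X) : Prop :=
  [/\ bochner_integrable mu g,
      strongly_measurable_wrt G g
    & forall B, G B -> bochner_integral mu B g = bochner_integral mu B f].

(* Main.v *)
(* A dual X carries a norming family of functionals of norm at most one, so Bochner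
   integrals, and hence conditional expectations, are characterised by scalar
   integrals.  Contractivity of E(. | G) on L_1, together with Radon-Nikodym
   densities for simple functions, yields existence.  For almost everywhere
   convergence along a countable set D of times, approximate E(f | F_oo) in L_1
   by a function measurable for some F_s and apply Doob's maximal inequality to
   the difference.

   Uncountably many times are reached as follows.  The L_1-valued map
   s |-> E(f | F_s) has left limits, so it is left continuous outside a countable
   set, which is put into D together with the rationals.  At any other s the
   given version is changed on an F_s-measurable null set so that its values lie
   in the closure of the values at rational times in ]s - 1, s[; the convergence
   along D then controls all large s. *)
Require Import Defs.
From HB Require Import structures.
From mathcomp Require Import all_boot all_order all_algebra.
From mathcomp Require Import all_classical all_reals all_analysis.
From mathcomp Require Import finmap measurable_realfun lra.
Import Order.TTheory GRing.Theory Num.Theory.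
Import numFieldNormedType.Exports.
Local Open Scope classical_set_scope.
Local Open Scope ring_scope.

Set Implicit Arguments.
Unset Strict Implicit.
Unset Printing Implicit Defensive.

(** * Strong measurability *)

(** The null sets of [mu] need not belong to [F s], and a repaired version at time [s] must remain
    [F s]-measurable. Only values at earlier times can therefore be used in its construction, and
    this is why left limits are the relevant ones. Contractivity is obtained without a conditional
    Jensen inequality. A set of [G] is cut into countably many pieces of [G] on which the
    conditional expectation is almost constant; for a constant, the norm of the integral is the
    integral of the norm, and the [ell] can test it. The bound holds on every set of [G], and this
    local form turns Doob's inequality into an induction over a sorted list of times, with no
    stopping time. Density of the functions measurable at some time is stated for an arbitrary
    nonempty set [K] of times: the whole line serves the limit at infinity, the times before [s]
    serve the left limit at [s]. *)

Notation "G .-mfun" := (measurable_fun (T := g_sigma_algebraType G) setT)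
  (at level 2, format "G .-mfun").

Section strong_measurability.
Context (T : pointedType) (R : realType) (G : set (set T)).
Hypothesis Gsig : sigma_algebra setT G.
Implicit Types (X Y Z : normedModType R) (A : set T).

(** The bridge from set systems to measurable types: a sigma-algebra generates nothing beyond
    itself. *)
Lemma gsetE A : G A = (G.-sigma.-measurable A).
Proof. by rewrite measurable_g_measurableTypeE. Qed.

Lemma gset_mem u : G.-mfun (u : T -> bool) -> G [set w | u w].
Proof.
move=> mu; rewrite gsetE; have := mu measurableT [set true] I.
by rewrite setTI; congr measurable; apply/seteqP; split => w /=; case: (u w).
Qed.

Lemma simple_wrt_cst X (c : X) : simple_wrt G (cst c : T -> X).
Proof.
split=> [|x]; first by apply: (sub_finite_set _ (finite_set1 c)) => _ [w _ <-].
rewrite gsetE; have [->|xc] := eqVneq x c.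
  by rewrite (_ : _ @^-1` _ = setT)//; apply/seteqP; split.
rewrite (_ : _ @^-1` _ = set0)//; apply/seteqP; split=> // w /=.
by move=> e; rewrite e eqxx in xc.
Qed.

Lemma simple_wrt_preimage X (s : T -> X) (B : set X) :
  simple_wrt G s -> G (s @^-1` B).
Proof.
move=> [fs ms]; rewrite (_ : s @^-1` B =
  \bigcup_(x in range s `&` B) (s @^-1` [set x])); last first.
  apply/seteqP; split=> w /=; first by move=> Bw; exists (s w).
  by move=> [x [_ Bx]] /= ->.
rewrite gsetE; apply: fin_bigcup_measurable.
  exact: finite_setIl.
by move=> x _; rewrite -gsetE.
Qed.

Lemma simple_wrt_comp X Z (phi : X -> Z) (s : T -> X) :
  simple_wrt G s -> simple_wrt G (phi \o s).
Proof.
move=> ss; split=> [|z]; last first.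
  by rewrite comp_preimage; exact: simple_wrt_preimage.
by rewrite -[range _](image_comp s phi); apply: finite_image; case: ss.
Qed.

Lemma simple_wrt_pair X Y (s : T -> X) (t : T -> Y) :
  simple_wrt G s -> simple_wrt G t ->
  simple_wrt G (fun w => (s w, t w)).
Proof.
move=> [fs ms] [ft mt]; split=> [|[x y]].
  apply: (sub_finite_set _ (finite_setX fs ft)) => _ [w _ <-] /=.
  by split; exists w.
rewrite (_ : _ @^-1` _ = s @^-1` [set x] `&` t @^-1` [set y]); last first.
  by apply/seteqP; split=> w /= [-> ->].
by rewrite gsetE; apply: measurableI; rewrite -gsetE.
Qed.

Lemma simple_wrt_if X A (s t : T -> X) : G A ->
  simple_wrt G s -> simple_wrt G t ->
  simple_wrt G (fun w => if w \in A then s w else t w).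
Proof.
move=> GA [fs ms] [ft mt]; split=> [|x].
  have fst : finite_set (range s `|` range t) by rewrite finite_setU.
  apply: (sub_finite_set _ fst) => _ [w _ <-].
  by case: ifP => _; [left|right]; exists w.
rewrite (_ : _ @^-1` _ = A `&` s @^-1` [set x] `|` ~` A `&` t @^-1` [set x]).
  rewrite gsetE; apply: measurableU; apply: measurableI; rewrite -?gsetE //.
  by rewrite gsetE; apply: measurableC; rewrite -gsetE.
apply/seteqP; split=> w /=.
  by case: ifPn => [/set_mem|/negP wA]; [left|right; split=> // /mem_set].
by move=> [] [Aw]; [rewrite mem_set|rewrite memNset].
Qed.

Lemma simple_wrt_mfun (s : T -> R^o) : simple_wrt G s -> G.-mfun (s : T -> R).
Proof.
move=> ss _ B _; rewrite setTI -[X in X _]/(measurable) -gsetE.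
exact: simple_wrt_preimage.
Qed.

Local Notation smeas := (strongly_measurable_wrt G).

Lemma smeas_simple X (s : T -> X) : simple_wrt G s -> smeas s.
Proof. by move=> ss; exists (fun=> s) => // w; exact: cvg_cst. Qed.

Lemma smeas_cst X (c : X) : smeas (cst c).
Proof. exact/smeas_simple/simple_wrt_cst. Qed.

Lemma smeas_comp X Z (phi : X -> Z) (f : T -> X) :
  continuous phi -> smeas f -> smeas (phi \o f).
Proof.
move=> cphi [s ss sf]; exists (fun n => phi \o s n).
  by move=> n; exact: simple_wrt_comp.
by move=> w; apply: continuous_cvg; [exact: cphi|exact: sf].
Qed.

Lemma smeas_pair X Y (f : T -> X) (g : T -> Y) :
  smeas f -> smeas g -> smeas (fun w => (f w, g w)).
Proof.
move=> [s ss sf] [t st tg]; exists (fun n w => (s n w, t n w)).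
  by move=> n; exact: simple_wrt_pair.
by move=> w; apply: cvg_pair; [exact: sf|exact: tg].
Qed.

Lemma smeas_norm X (f : T -> X) :
  smeas f -> smeas (fun w => (`|f w| : R^o)).
Proof. by apply: smeas_comp => x; exact: norm_continuous. Qed.

Lemma smeasN X (f : T -> X) : smeas f -> smeas (fun w => - f w).
Proof. by apply: smeas_comp => x; exact: opp_continuous. Qed.

Lemma smeasD X (f g : T -> X) :
  smeas f -> smeas g -> smeas (fun w => f w + g w).
Proof.
move=> mf mg.
have := smeas_pair mf mg => /(@smeas_comp _ _ (fun p : X * X => p.1 + p.2)).
by apply=> x; exact: add_continuous.
Qed.

Lemma smeasB X (f g : T -> X) :
  smeas f -> smeas g -> smeas (fun w => f w - g w).
Proof. by move=> mf mg; apply: smeasD => //; exact: smeasN. Qed.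

Lemma smeasZ X (f : T -> R^o) (c : X) :
  smeas f -> smeas (fun w => f w *: c).
Proof.
move=> mf; exact: (@smeas_comp R^o X (fun a => a *: c) f (@scalel_continuous _ _ c) mf).
Qed.

Lemma smeas_mfun (f : T -> R^o) : smeas f -> G.-mfun (f : T -> R).
Proof.
move=> [s ss sf]; apply: (@measurable_fun_cvg _ (g_sigma_algebraType G) R setT s).
  by move=> n; exact: simple_wrt_mfun.
by move=> w _; exact: sf.
Qed.

Lemma smeas_norm_mfun X (f : T -> X) : smeas f -> G.-mfun (fun w => `|f w|).
Proof. by move=> /smeas_norm/smeas_mfun. Qed.

Lemma dense_seq X : separable X -> exists e : nat -> X,
  forall (x : X) (r : R), 0 < r -> exists k, `|x - e k| < r.
Proof.
move=> [D /countable_injP[i injI] Dd].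
have Dr (x : X) r : 0 < r -> exists2 y, D y & `|x - y| < r.
  move=> r0; have [y [xy Dy]] : ball x r `&` D !=set0.
    by apply: Dd; [exists x; exact: ballxx|exact: ball_open].
  by exists y => //; move: xy; rewrite -ball_normE.
exists (fun k => xget 0 [set x | D x /\ i x = k]) => x r /(Dr x)[y Dy xy].
exists (i y); case: xgetP => [z _ [Dz iz]|/(_ y)].
  by rewrite (injI z y)// in_setE.
by move=> /not_andP[].
Qed.

(* Successive best approximations by elements of a dense sequence. *)
Lemma smeas_dist X (f : T -> X) : separable X ->
  (forall c, G.-mfun (fun w => `|f w - c|)) -> smeas f.
Proof.
move=> /dense_seq[e eD] mf.
pose s := fix s n : T -> X := if n is n'.+1 then
  (fun w => if w \in [set w | `|f w - e n| < `|f w - s n' w|]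
            then e n else s n' w) else cst (e 0%N).
have [ss sm] : (forall n, simple_wrt G (s n)) /\
    (forall n, G.-mfun (fun w => `|f w - s n w|)).
  suff H n : simple_wrt G (s n) /\ G.-mfun (fun w => `|f w - s n w|).
    by split=> n; case: (H n).
  elim: n => [|n [sn mn]]; first by split; [exact: simple_wrt_cst|exact: mf].
  have Gn : G [set w | `|f w - e n.+1| < `|f w - s n w|].
    by apply/gset_mem/measurable_fun_ltr.
  split; first by apply: simple_wrt_if => //; exact: simple_wrt_cst.
  apply: (@eq_measurable_fun _ _ (g_sigma_algebraType G) _ setT
    ((fun w => `|f w - e n.+1|) \min (fun w => `|f w - s n w|))).
    move=> w _ /=; rewrite /Order.min; case: ifPn => h.
      by rewrite mem_set.
    by rewrite memNset//=; exact/negP.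
  exact: measurable_minr.
have le1 w n : `|f w - s n.+1 w| <= `|f w - e n.+1| /\
    `|f w - s n.+1 w| <= `|f w - s n w|.
  rewrite /=; case: ifPn => [/set_mem/ltW//|/negP wn]; split=> //.
  by rewrite leNgt; apply/negP => h; apply: wn; rewrite in_setE.
have leM w : {homo (fun n => `|f w - s n w|) : n m / (n <= m)%N >-> m <= n}.
  by apply/nonincreasing_seqP => n; case: (le1 w n).
exists s => // w; apply/cvgrPdist_lt => r r0.
have [k kr] := eD (f w) r r0.
near=> n; apply: le_lt_trans kr.
have kn : (k <= n)%N by near: n; exact: nbhs_infty_ge.
apply: (le_trans (leM w _ _ kn)).
by case: (k) => [//|k']; case: (le1 w k').
Unshelve. all: by end_near. Qed.

Lemma mfun_smeas (u : T -> R) : G.-mfun u -> smeas (u : T -> R^o).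
Proof.
move=> mu; apply: smeas_dist; last first.
  by move=> c; apply: measurableT_comp => //; exact: measurable_funB.
exists (range (@ratr R)); last exact: dense_rat.
by apply: sub_countable (countableP setT); exact: card_image_le.
Qed.

(** By separability only the distances to fixed points have to be measurable, and these are limits
    of scalar functions. *)
Lemma smeas_lim X (f : nat -> T -> X) (g : T -> X) : separable X ->
  (forall n, smeas (f n)) -> (forall w, f n w @[n --> \oo] --> g w) -> smeas g.
Proof.
move=> sX mf fg; apply: smeas_dist => // c.
apply: (@measurable_fun_cvg _ (g_sigma_algebraType G) R setT (fun n w => `|f n w - c|)).
  by move=> n; apply: smeas_norm_mfun; apply: smeasB => //; exact: smeas_cst.
move=> w _; apply: cvg_norm; apply: cvgB; [exact: fg|exact: cvg_cst].
Qed.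

Lemma smeas_if X A (f g : T -> X) : G A -> smeas f -> smeas g ->
  smeas (fun w => if w \in A then f w else g w).
Proof.
move=> GA [s ss sf] [t st tg].
exists (fun n w => if w \in A then s n w else t n w).
  by move=> n; exact: simple_wrt_if.
by move=> w; case: ifP => _; [exact: sf|exact: tg].
Qed.

Lemma smeas_indic X A (c : X) : G A -> smeas (fun w => (\1_A w : R) *: c).
Proof.
move=> GA; rewrite (_ : (fun w => _) = fun w => if w \in A then c else 0).
  by apply: smeas_if => //; exact: smeas_cst.
by apply/funext => w; rewrite indicE; case: ifP; rewrite ?scale1r ?scale0r.
Qed.

End strong_measurability.

Lemma simple_wrt_sub (T : Type) (R : realType) (X : normedModType R)
    (G H : set (set T)) (s : T -> X) :
  G `<=` H -> simple_wrt G s -> simple_wrt H s.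
Proof. by move=> GH [fs ms]; split=> // x; exact: GH. Qed.

Lemma smeas_sub (T : Type) (R : realType) (X : normedModType R)
    (G H : set (set T)) (f : T -> X) :
  G `<=` H -> strongly_measurable_wrt G f -> strongly_measurable_wrt H f.
Proof.
by move=> GH [s ss sf]; exists s => // n; exact: simple_wrt_sub GH _.
Qed.

Lemma mfun_sub d (T : measurableType d) d' (U : measurableType d') 
    (G : set (set T)) (u : T -> U) : sigma_algebra setT G ->
  G `<=` measurable -> G.-mfun u -> measurable_fun setT u.
Proof.
move=> Gs Gm mu _ B mB; apply: Gm.
by rewrite (gsetE Gs); exact: mu.
Qed.

(** * The space L_1 *)

Section bochner_norm.
Context (d : measure_display) (T : measurableType d) (R : realType)
  (mu : {finite_measure set T -> \bar R}) (X : normedModType R).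
Implicit Types (f g h : T -> X) (D : set T).

Definition bnorm D f : \bar R := (\int[mu]_(w in D) (`|f w|%:E))%E.

Local Notation smeas := (strongly_measurable_wrt (@measurable d T)).
Local Notation L1 := (bochner_integrable mu).

Lemma smeas_measurable_norm D f :
  smeas f -> measurable_fun D (fun w => `|f w|%:E).
Proof.
move=> mf; apply/measurable_EFinP/measurable_funTS.
apply: mfun_sub (sigma_algebra_measurable T) _ _ => //.
by apply: smeas_norm_mfun mf; exact: sigma_algebra_measurable.
Qed.

Lemma bnorm_ge0 D f : (0 <= bnorm D f)%E.
Proof. by apply: integral_ge0 => w _; rewrite lee_fin. Qed.

Lemma bnormT D f : measurable D -> smeas f -> (bnorm D f <= bnorm setT f)%E.
Proof.
move=> mD mf; apply: ge0_subset_integral => //.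
exact: smeas_measurable_norm.
Qed.

Lemma le_bnormD D f g h : measurable D -> smeas f -> smeas g -> smeas h ->
  (forall w, D w -> `|h w| <= `|f w| + `|g w|) ->
  (bnorm D h <= bnorm D f + bnorm D g)%E.
Proof.
move=> mD mf mg mh hfg; rewrite /bnorm -ge0_integralD//.
- apply: ge0_le_integral => //.
  + exact: smeas_measurable_norm.
  + by apply: emeasurable_funD; exact: smeas_measurable_norm.
- exact: smeas_measurable_norm.
- exact: smeas_measurable_norm.
Qed.

Lemma L1_smeas f : L1 f -> smeas f. Proof. by case. Qed.

Lemma L1_norm_integrable D f : measurable D -> L1 f ->
  mu.-integrable D (fun w => `|f w|%:E).
Proof.
move=> mD [mf If]; apply/integrableP; split; first exact: smeas_measurable_norm.
apply: le_lt_trans If; rewrite (_ : (\int[mu]_(_ in D) _)%E = bnorm D f).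
  exact: bnormT.
by apply: eq_integral => w _; rewrite gee0_abs// lee_fin.
Qed.

Lemma bnorm_lty D f : measurable D -> L1 f -> (bnorm D f < +oo)%E.
Proof. by move=> mD [mf If]; exact: le_lt_trans (bnormT _ _) If. Qed.

Lemma bnorm_fin_num D f : measurable D -> L1 f -> bnorm D f \is a fin_num.
Proof. by move=> mD If; rewrite ge0_fin_numE ?bnorm_ge0 ?bnorm_lty. Qed.

Lemma L1_leD f g h : L1 f -> L1 g -> smeas h ->
  (forall w, `|h w| <= `|f w| + `|g w|) -> L1 h.
Proof.
move=> [mf If] [mg Ig] mh hfg; split=> //.
apply: (@le_lt_trans _ _ (bnorm setT f + bnorm setT g)%E).
  by apply: le_bnormD.
by rewrite lte_add_pinfty.
Qed.

Lemma L1D f g : L1 f -> L1 g -> L1 (fun w => f w + g w).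
Proof.
move=> If Ig; apply: (L1_leD If Ig); last by move=> w; exact: ler_normD.
by apply: smeasD; [exact: sigma_algebra_measurable|exact: L1_smeas..].
Qed.

Lemma L1N f : L1 f -> L1 (fun w => - f w).
Proof.
move=> If; apply: (L1_leD If If); last by move=> w; rewrite normrN lerDl.
by apply: smeasN; [exact: sigma_algebra_measurable|exact: L1_smeas].
Qed.

Lemma L1B f g : L1 f -> L1 g -> L1 (fun w => f w - g w).
Proof. by move=> If Ig; apply: L1D => //; exact: L1N. Qed.

Lemma L1_simple (s : T -> X) : simple_wrt measurable s -> L1 s.
Proof.
move=> ss; have ms := smeas_simple ss.
split=> //; have [c cs] : exists c, forall w, `|s w| <= c.
  have [fs _] := ss; have [c [_ h]] := compact_bounded (finite_compact fs).
  by exists (c + 1) => w; apply: (h (c + 1)); [rewrite ltrDl|exists w].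
apply: (@le_lt_trans _ _ (\int[mu]_w (cst c%:E w))%E).
  apply: ge0_le_integral => //; first exact: smeas_measurable_norm.
  by move=> w _; rewrite lee_fin.
rewrite integral_cst//= ltey_eq fin_numM// fin_num_measure//.
Qed.

Lemma L1_indic (A : set T) (c : X) : measurable A ->
  L1 (fun w => (\1_A w : R) *: c).
Proof.
move=> mA; apply: L1_simple.
rewrite (_ : (fun w => _) = fun w => if w \in A then c else 0).
  have sT := sigma_algebra_measurable T.
  by apply: simple_wrt_if => //; exact: simple_wrt_cst.
by apply/funext => w; rewrite indicE; case: ifP; rewrite ?scale1r ?scale0r.
Qed.

Lemma bnorm_cst_indic D (A : set T) (c : X) : measurable D -> measurable A ->
  bnorm D (fun w => (\1_A w : R) *: c) = (`|c|%:E * mu (A `&` D))%E.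
Proof.
move=> mD mA; rewrite /bnorm.
under eq_integral do rewrite normrZ mulrC EFinM.
rewrite ge0_integralZl_EFin//; last first.
  by apply/measurable_EFinP/measurableT_comp => //; exact: measurable_indic.
congr (_ * _)%E; rewrite -integral_indic//.
by apply: eq_integral => w _; rewrite indicE; case: (w \in A); rewrite ?normr1 ?normr0.
Qed.

(** The simple functions [s n] given by strong measurability need not be dominated. Setting them to
    0 where their norm exceeds [2 * |f|] does not increase the error, since there [|f| < |f - s n|],
    and bounds it by [3 * |f|]; dominated convergence then applies. *)
Lemma bnorm_approx (G : set (set T)) f : sigma_algebra setT G -> 
  G `<=` measurable -> strongly_measurable_wrt G f -> L1 f ->
  exists s : nat -> T -> X, (forall n, simple_wrt G (s n)) /\
    bnorm setT (fun w => f w - s n w) @[n --> \oo] --> 0%E.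
Proof.
move=> Gs Gm mf If; have [s ss sf] := mf.
pose A n := [set w | `|s n w| <= 2 * `|f w|].
pose t n w := if w \in A n then s n w else 0.
have At n w : `|f w - t n w| <= `|f w - s n w|.
  rewrite /t; case: ifPn => // /negP wA; rewrite subr0.
  have : 2 * `|f w| < `|s n w|.
    by rewrite ltNge; apply/negP => h; apply: wA; rewrite in_setE.
  by have := ler_normD (f w) (s n w - f w); rewrite subrKC (distrC (f w)); lra.
have At3 n w : `|f w - t n w| <= 3 * `|f w|.
  apply: le_trans (ler_normB _ _) _; rewrite /t; case: ifPn => [/set_mem|_].
    by rewrite /A/=; lra.
  by rewrite normr0; have := normr_ge0 (f w); lra.
have st n : simple_wrt G (t n).
  apply: simple_wrt_if => //; last exact: simple_wrt_cst.
  apply: gset_mem => //; apply: measurable_fun_ler.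
    by apply: smeas_norm_mfun => //; exact: smeas_simple.
  apply: (measurable_funM (@measurable_cst _ _ (g_sigma_algebraType G) _ _ _)).
  exact: smeas_norm_mfun.
exists t; split=> //.
have mt n : measurable_fun setT (fun w => `|f w - t n w|%:E).
  apply: smeas_measurable_norm; apply: smeas_sub Gm _.
  by apply: smeasB => //; exact: smeas_simple.
have ig : mu.-integrable setT (fun w => (3%:E * `|f w|%:E)%E).
  exact/integrableZl/L1_norm_integrable.
have [| | |_ _] := @dominated_convergence _ _ _ mu setT measurableT
  (fun n w => `|f w - t n w|%:E) (cst 0%E) _ mt _ _ ig.
- exact: measurable_cst.
- apply: aeW => w _; apply/cvg_EFin.
    by near=> n.
  apply/cvgr0Pnorm_lt => e e0; near=> n.
  rewrite /= normr_id; apply: le_lt_trans (At n w) _.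
  by near: n; move: e e0; apply/cvgrPdist_lt; exact: sf.
- apply: aeW => w n _; rewrite lee_fin normr_id; exact: At3.
by rewrite integral0.
Unshelve. all: by end_near. Qed.

End bochner_norm.

(** * Bochner integrals through a norming family *)

(** The norm is the least upper bound of the [|ell i x|]. For a dual space, evaluations at the unit
    ball of the predual form such a family; the second clause is stated so that a norm estimate
    reduces at once to scalar ones. *)
Definition norming_family (R : realType) (X : normedModType R) (I : Type)
    (ell : I -> {linear X -> R^o}) :=
  (forall i x, `|ell i x| <= `|x|) /\
  (forall x c, (forall i, `|ell i x| <= c) -> `|x| <= c).

Lemma cvg_bnd (R : realType) (X : normedModType R) (a : nat -> X) (v : X)
    (e : nat -> \bar R) : (forall n, (`|v - a n|%:E <= e n)%E) ->
  e n @[n --> \oo] --> 0%E -> a n @[n --> \oo] --> v.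
Proof.
move=> ae e0; apply/cvgrPdist_lt => r r0.
have : \forall n \near \oo, (e n < r%:E)%E.
  apply: (e0 [set x | (x < r%:E)%E]); apply: open_nbhs_nbhs.
  by split; [exact: open_ereal_lt_ereal|rewrite /= lte_fin].
by apply: filterS => n /(le_lt_trans (ae n)); rewrite lte_fin.
Qed.

Section bochner_integral_theory.
Context (d : measure_display) (T : measurableType d) (R : realType)
  (mu : {finite_measure set T -> \bar R}) (X : completeNormedModType R)
  (I : Type) (ell : I -> {linear X -> R^o}).
Hypothesis ellN : norming_family ell.
Implicit Types (f g h : T -> X) (D : set T).

Local Notation smeas := (strongly_measurable_wrt (@measurable d T)).
Local Notation L1 := (bochner_integrable mu).

Lemma ell_continuous i : continuous (ell i).
Proof.
move=> x; apply/cvgrPdist_lt => e e0; near=> y.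
rewrite -linearB; apply: le_lt_trans (ellN.1 _ _) _.
by near: y; move: e e0; apply/cvgrPdist_lt; exact: cvg_id.
Unshelve. all: by end_near. Qed.

Lemma ell_eq (x y : X) : (forall i, ell i x = ell i y) -> x = y.
Proof.
move=> xy; apply/eqP; rewrite -subr_eq0 -normr_le0; apply: ellN.2 => i.
by rewrite linearB xy subrr normr0.
Qed.

Lemma ell_smeas (G : set (set T)) i f :
  sigma_algebra setT G ->
  strongly_measurable_wrt G f -> strongly_measurable_wrt G (ell i \o f).
Proof. by move=> Gs; apply: smeas_comp => //; exact: ell_continuous. Qed.

Lemma ell_integrable D i f : measurable D -> L1 f ->
  mu.-integrable D (fun w => (ell i (f w))%:E).
Proof.
move=> mD If; apply: (le_integrable mD) (L1_norm_integrable mD If).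
  apply/measurable_EFinP/measurable_funTS.
  apply: mfun_sub (sigma_algebra_measurable T) _ _ => //.
  apply: smeas_mfun; first exact: sigma_algebra_measurable.
  by apply: ell_smeas (L1_smeas If); exact: sigma_algebra_measurable.
by move=> w _; rewrite lee_fin normr_id; exact: ellN.1.
Qed.

Lemma ell_integral_le D i f : measurable D -> L1 f ->
  (`|\int[mu]_(w in D) (ell i (f w))%:E| <= bnorm mu D f)%E.
Proof.
move=> mD If; have mi := ell_integrable i mD If.
apply: le_trans (le_abse_integral _ mD (measurable_int _ mi)) _.
apply: ge0_le_integral => //.
- exact/measurableT_comp/(measurable_int _ mi).
- exact: smeas_measurable_norm (L1_smeas If).
- by move=> w _; rewrite lee_fin; exact: ellN.1.
Qed.

Lemma ell_integralB D i f g : measurable D -> L1 f -> L1 g ->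
  (\int[mu]_(w in D) (ell i (f w - g w))%:E =
   \int[mu]_(w in D) (ell i (f w))%:E - \int[mu]_(w in D) (ell i (g w))%:E)%E.
Proof.
move=> mD If Ig; rewrite -integralB_EFin//; try exact: ell_integrable.
by apply: eq_integral => w _; rewrite linearB EFinB.
Qed.

Lemma ell_integralD D i f g : measurable D -> L1 f -> L1 g ->
  (\int[mu]_(w in D) (ell i (f w + g w))%:E =
   \int[mu]_(w in D) (ell i (f w))%:E + \int[mu]_(w in D) (ell i (g w))%:E)%E.
Proof.
move=> mD If Ig; rewrite -integralD_EFin//; try exact: ell_integrable.
by apply: eq_integral => w _; rewrite linearD EFinD.
Qed.

Lemma ell_integral_fin_num D i f : measurable D -> L1 f ->
  (\int[mu]_(w in D) (ell i (f w))%:E)%E \is a fin_num.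
Proof. by move=> mD If; apply: integrable_fin_num => //; exact: ell_integrable. Qed.

Lemma ell_simple_integral D i s : measurable D -> simple_wrt measurable s ->
  (ell i (simple_integral mu D s))%:E = (\int[mu]_(w in D) (ell i (s w))%:E)%E.
Proof.
move=> mD ss; have [fs ms] := ss.
have DE : D = \big[setU/set0]_(x <- fset_set (range s)) (D `&` s @^-1` [set x]).
  rewrite -bigcup_seq; apply/seteqP; split=> [w Dw|w [x _ []//]].
  exists (s w); last by [].
  by rewrite /= in_fset_set//; apply/mem_set; exists w.
rewrite [in RHS]DE integral_bigsetU_EFin//=; last 3 first.
- by move=> x; apply: measurableI.
- apply/trivIsetP => x y _ _ /= xy; rewrite -subset0 => w [[_ wx] [_ wy]].
  by move: xy; rewrite -(wx : s w = x) -(wy : s w = y) eqxx.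
- rewrite -DE; apply: (measurable_int mu); apply: ell_integrable => //; exact: L1_simple.
rewrite /simple_integral fsbig_finite//= linear_sum -sumEFin; apply: eq_bigr => x _.
rewrite linearZ/= EFinM fineK ?fin_num_measure//; last exact: measurableI.
transitivity (\int[mu]_(w in D `&` s @^-1` [set x]) (cst (ell i x)%:E) w)%E.
  by rewrite integral_cst 1?muleC//; exact: measurableI.
by apply: eq_integral => w /set_mem[_ <-].
Qed.

(** Against each functional, [f] and [s n] have integrals differing by at most their L_1 distance.
    Since the family separates points, the value is unique and independent of the approximating
    sequence. *)
Lemma is_bochner_integralP D f v : measurable D -> L1 f ->
  is_bochner_integral mu D f v ->
  forall i, (ell i v)%:E = (\int[mu]_(w in D) (ell i (f w))%:E)%E.
Proof.
move=> mD If [s [ss sf sv]] i.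
have fin := ell_integral_fin_num i mD If.
rewrite -(fineK fin); congr EFin.
have h1 : ell i (simple_integral mu D (s n)) @[n --> \oo] --> ell i v.
  by apply: continuous_cvg; [exact: ell_continuous|exact: sv].
apply: (cvg_unique (@norm_hausdorff R R^o) h1).
apply: cvg_bnd sf => n.
have Is := L1_simple mu (ss n).
rewrite -abse_EFin EFinB fineK// ell_simple_integral//.
by rewrite -ell_integralB//; apply: ell_integral_le => //; exact: L1B.
Qed.

Lemma bochner_integral_exists D f : measurable D -> L1 f ->
  exists v, is_bochner_integral mu D f v.
Proof.
move=> mD If; have [s [ss sf]] :=
  bnorm_approx (sigma_algebra_measurable T) (fun _ => id) (L1_smeas If) If.
have Is n := L1_simple mu (ss n).
have sfD : bnorm mu D (fun w => f w - s n w) @[n --> \oo] --> 0%E.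
  apply: squeeze_cvge (cvg_cst 0%E) sf; apply: nearW => n; rewrite bnorm_ge0/=.
  by apply: bnormT => //; apply: L1_smeas; apply: L1B If (Is n).
suff /cauchy_cvg/cvg_ex[v sv] : cauchy (simple_integral mu D (s n) @[n --> \oo]).
  by exists v, s.
apply/cauchy_exP => e e0.
(* Two approximation errors add up to [e / 2]. The margin up to [e] is needed because testing with
   functionals yields only a non-strict inequality. *)
have : \forall n \near \oo, (bnorm mu D (fun w => f w - s n w)%R < (e / 4)%:E)%E.
  apply: (sfD [set x | (x < (e / 4)%:E)%E]); apply: open_nbhs_nbhs.
  by split; [exact: open_ereal_lt_ereal|rewrite /= lte_fin divr_gt0].
move=> [N _ Ne]; exists (simple_integral mu D (s N)); exists N => // n /= Nn.
rewrite -ball_normE/=; apply: (@le_lt_trans _ _ (e / 2)); last by lra.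
apply: ellN.2 => i; rewrite -lee_fin linearB/= -abse_EFin EFinB.
rewrite !ell_simple_integral// -ell_integralB//.
apply: le_trans (ell_integral_le _ mD (L1B (Is N) (Is n))) _.
rewrite (_ : e / 2 = e / 4 + e / 4); last by lra.
rewrite EFinD; apply: le_trans (leeD (ltW (Ne _ Nn)) (ltW (Ne _ (leqnn N)))).
have ms k : smeas (fun w => f w - s k w) := L1_smeas (L1B If (Is k)).
apply: le_bnormD => //; first exact: L1_smeas (L1B (Is N) (Is n)).
move=> w _; have := ler_normB (f w - s n w) (f w - s N w).
by rewrite opprB addrC addrA subrK.
Qed.

Lemma bochner_integralP D f : measurable D -> L1 f ->
  forall i, (ell i (bochner_integral mu D f))%:E =
    (\int[mu]_(w in D) (ell i (f w))%:E)%E.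
Proof.
move=> mD If; apply: is_bochner_integralP => //; rewrite /bochner_integral.
by case: xgetP => // nov; have [v /nov] := bochner_integral_exists mD If.
Qed.

(** The averaging identity tested by functionals. Integrability and measurability of [g] are kept
    apart, so that the identity can be added, subtracted and passed to the limit by scalar
    integration alone. *)
Definition scalar_cond_exp (G : set (set T)) f g :=
  forall B i, G B -> (\int[mu]_(w in B) (ell i (g w))%:E =
                      \int[mu]_(w in B) (ell i (f w))%:E)%E.

Lemma is_cond_expP (G : set (set T)) f g : G `<=` measurable -> L1 f ->
  is_cond_exp mu G f g <->
  [/\ L1 g, strongly_measurable_wrt G g & scalar_cond_exp G f g].
Proof.
move=> Gm If; split=> -[Ig mg fg]; split=> //.
  by move=> B i GB; rewrite -!bochner_integralP// ?fg//; exact: Gm.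
move=> B GB; apply: ell_eq => i; apply: EFin_inj.
by rewrite !bochner_integralP ?fg//; exact: Gm.
Qed.

End bochner_integral_theory.

(** * Contractivity of conditional expectations *)

Section cond_exp_contraction.
Context (d : measure_display) (T : measurableType d) (R : realType)
  (mu : {finite_measure set T -> \bar R}) (X : completeNormedModType R)
  (I : Type) (ell : I -> {linear X -> R^o}).
Hypothesis ellN : norming_family ell.
Hypothesis X_separable : separable X.
Implicit Types (f g h u m : T -> X) (A B C D : set T) (G : set (set T)).

Local Notation smeas := (strongly_measurable_wrt (@measurable d T)).
Local Notation L1 := (bochner_integrable mu).

Lemma scalar_cond_expB G f f' g g' : G `<=` measurable ->
  L1 f -> L1 f' -> L1 g -> L1 g' ->
  scalar_cond_exp mu ell G f g -> scalar_cond_exp mu ell G f' g' ->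
  scalar_cond_exp mu ell G (fun w => f w - f' w) (fun w => g w - g' w).
Proof.
move=> Gm If If' Ig Ig' fg fg' B i GB; have mB := Gm _ GB.
by rewrite !(ell_integralB ellN)// fg// fg'.
Qed.

Lemma scalar_cond_expD G f f' g g' : G `<=` measurable ->
  L1 f -> L1 f' -> L1 g -> L1 g' ->
  scalar_cond_exp mu ell G f g -> scalar_cond_exp mu ell G f' g' ->
  scalar_cond_exp mu ell G (fun w => f w + f' w) (fun w => g w + g' w).
Proof.
move=> Gm If If' Ig Ig' fg fg' B i GB; have mB := Gm _ GB.
by rewrite !(ell_integralD ellN)// fg// fg'.
Qed.

(** Both norms are compared with [|c| * mu C]. Replacing [m] by [c] under the norm costs one [e];
    replacing the integral of [c] by that of [m], which against each functional is that of [u],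
    costs the other. *)
Lemma cst_bound_integral C u m (c : X) (e : R) : measurable C ->
  L1 u -> L1 m -> (forall w, C w -> `|m w - c| < e) ->
  (forall i, \int[mu]_(w in C) (ell i (m w))%:E =
             \int[mu]_(w in C) (ell i (u w))%:E)%E ->
  (bnorm mu C m <= bnorm mu C u + (2 * e)%:E * mu C)%E.
Proof.
move=> mC Iu Im me mE.
have Ic : L1 (cst c).
  by apply: L1_simple; apply: simple_wrt_cst; exact: sigma_algebra_measurable.
have muC : mu C \is a fin_num by exact: fin_num_measure.
have cst_le (v : T -> X) : smeas v -> (forall w, C w -> `|v w| <= e) ->
    (bnorm mu C v <= e%:E * mu C)%E.
  move=> mv ve; rewrite -(integral_cst mu mC); apply: ge0_le_integral => //.
  exact: smeas_measurable_norm.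
have cm : (bnorm mu C (fun w => c - m w)%R <= e%:E * mu C)%E.
  apply: cst_le; first exact: (L1_smeas (L1B Ic Im)).
  by move=> w Cw; rewrite distrC; exact/ltW/me.
have cE : bnorm mu C (cst c) = (`|c|%:E * mu C)%E by rewrite -(integral_cst mu mC).
have mc : (bnorm mu C m <= e%:E * mu C + `|c|%:E * mu C)%E.
  rewrite -cE; apply: le_trans (leeD2r _ cm).
  have mB := L1_smeas (L1B Ic Im).
  apply: le_bnormD => //; [exact: L1_smeas Ic|exact: L1_smeas Im|].
  move=> w _; have := ler_normB c (c - m w).
  by rewrite opprB addrC subrK addrC.
apply: (le_trans mc).
have bu := bnorm_fin_num mC Iu.
suff : (`|c|%:E * mu C <= bnorm mu C u + e%:E * mu C)%E.
  by rewrite -(fineK muC) -(fineK bu) -!EFinM -!EFinD !lee_fin; lra.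
have r0 : 0 <= fine (mu C) by rewrite fine_ge0.
rewrite -(fineK muC) -(fineK bu) -!EFinM -!EFinD lee_fin mulrC -[X in X * _]ger0_norm//.
rewrite -normrZ; apply: ellN.2 => i; rewrite linearZ/= -lee_fin -abse_EFin EFinM.
rewrite fineK// muleC -(integral_cst mu mC).
have -> : (\int[mu]_(w in C) cst (ell i c)%:E w =
    \int[mu]_(w in C) (ell i (c - m w)%R)%:E + \int[mu]_(w in C) (ell i (u w))%:E)%E.
  by rewrite (ell_integralB ellN)// -mE subeK// (ell_integral_fin_num ellN).
apply: le_trans (lee_abs_add _ _) _; rewrite addeC EFinD EFinM !fineK//.
apply: leeD; first exact: (ell_integral_le ellN).
by apply: le_trans cm; apply: (ell_integral_le ellN) => //; exact: L1B.
Qed.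

(** Balls of radius [r] about a dense sequence, made disjoint and intersected with [B], are sets of
    [G] on which [m] is almost constant. The averaging identity holds on each piece, and the errors
    sum to at most [2 * r * mu B]. *)
Lemma cond_exp_contraction G u m B : sigma_algebra setT G -> G `<=` measurable ->
  L1 u -> L1 m -> strongly_measurable_wrt G m -> scalar_cond_exp mu ell G u m ->
  G B -> (bnorm mu B m <= bnorm mu B u)%E.
Proof.
move=> Gs Gm Iu Im mm um GB; have mB := Gm _ GB.
apply/lee_addgt0Pr => e e0.
have [e_ e_D] := dense_seq X_separable.
have muB : mu B \is a fin_num by exact: fin_num_measure.
(* Chosen to make [2 * r * mu B <= e]; the added 1 covers the case [mu B = 0]. *)
pose r := e / (2 * (fine (mu B) + 1)).
have B1 : 0 < fine (mu B) + 1 by rewrite ltr_wpDl// fine_ge0.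
have r0 : 0 < r by rewrite divr_gt0// mulr_gt0.
pose A k := [set w | `|m w - e_ k| < r].
have GA k : G (A k).
  apply: gset_mem => //; apply: measurable_fun_ltr => //.
  by apply: smeas_norm_mfun => //; apply: smeasB => //; exact: smeas_cst.
have UA : \bigcup_k A k = setT.
  by apply/seteqP; split=> // w _; have [k ke] := e_D (m w) r r0; exists k.
pose C k := B `&` seqDU A k.
have GC k : G (C k).
  rewrite (gsetE Gs); apply: measurableI; first by rewrite -(gsetE Gs).
  apply: measurableD; first by rewrite -(gsetE Gs).
  by apply: bigsetU_measurable => i _; rewrite -(gsetE Gs).
have mC k : measurable (C k) by exact: Gm.
have BC : B = \bigcup_k C k.
  by rewrite -setI_bigcupr -seqDU_bigcup_eq UA setIT.
have tC : trivIset setT C.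
  exact/trivIset_setIl/trivIset_seqDU.
pose v w := (`|u w| + 2 * r)%:E.
have mv : measurable_fun setT v.
  apply/measurable_EFinP/measurable_funD => //.
  by apply/measurable_EFinP; exact: smeas_measurable_norm (L1_smeas Iu).
have v0 w : (0 <= v w)%E by rewrite lee_fin addr_ge0// mulr_ge0// ltW.
have vE D : measurable D -> (\int[mu]_(w in D) v w = bnorm mu D u + (2 * r)%:E * mu D)%E.
  move=> mD; rewrite -(integral_cst mu mD) /bnorm -ge0_integralD//.
  - exact: (smeas_measurable_norm (L1_smeas Iu)).
  - by move=> w _; rewrite lee_fin mulr_ge0// ltW.
apply: (@le_trans _ _ (\int[mu]_(w in B) v w)%E).
  rewrite /bnorm BC !ge0_integral_bigcup//.
  - apply: lee_nneseries => k _; first by move=> _; exact: bnorm_ge0.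
    rewrite vE//; apply: (@cst_bound_integral _ _ _ (e_ k)) => //.
      by move=> w [_ [Aw _]].
    by move=> i; exact: um.
  - exact: measurable_funTS.
  - exact: (smeas_measurable_norm (L1_smeas Im)).
rewrite vE// leeD2l// -(fineK muB) -EFinM lee_fin.
have rE : r * (2 * (fine (mu B) + 1)) = e by rewrite divfK// mulf_neq0// gt_eqF.
by move: rE r0; nra.
Qed.

Lemma cond_exp_L1 G u m : sigma_algebra setT G -> G `<=` measurable ->
  L1 u -> L1 m -> strongly_measurable_wrt G m -> scalar_cond_exp mu ell G u m ->
  (bnorm mu setT m <= bnorm mu setT u)%E.
Proof.
move=> Gs Gm Iu Im mm um; apply: cond_exp_contraction um _ => //.
by rewrite (gsetE Gs).
Qed.

End cond_exp_contraction.

(** * Induction and completeness in L_1 *)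

Section L1_induction.
Context (d : measure_display) (T : measurableType d) (R : realType)
  (mu : {finite_measure set T -> \bar R}) (X : normedModType R)
  (G : set (set T)).
Hypotheses (Gs : sigma_algebra setT G) (Gm : G `<=` measurable).
Local Notation L1 := (bochner_integrable mu).
Local Notation Gmeas := (strongly_measurable_wrt G).

(** Serves twice: for the existence of conditional expectations and for the density of the functions
    measurable at some time. *)
Lemma L1_ind (P : (T -> X) -> Prop) :
  (forall A c, G A -> P (fun w => (\1_A w : R) *: c)) ->
  (forall f g, L1 f -> L1 g -> Gmeas f -> Gmeas g -> P f -> P g ->
    P (fun w => f w + g w)) ->
  (forall f, L1 f -> Gmeas f ->
    (forall e : R, 0 < e -> exists g, [/\ L1 g, Gmeas g, P g &
      (bnorm mu setT (fun w => f w - g w)%R < e%:E)%E]) -> P f) ->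
  forall f, L1 f -> Gmeas f -> P f.
Proof.
move=> P1 PD Plim f If mf.
have Pindic A c : G A -> let s := (fun w => (\1_A w : R) *: c) in
    [/\ L1 s, Gmeas s & P s].
  move=> GA s; split; last exact: P1.
    by apply: L1_indic; exact: Gm.
  exact: smeas_indic.
have Psimple s : simple_wrt G s -> [/\ L1 s, Gmeas s & P s].
  move=> [fs ms].
  have sE : s = fun w => \sum_(x <- fset_set (range s)) (\1_(s @^-1` [set x]) w : R) *: x.
    apply/funext => w; rewrite (big_fsetD1 (s w)) /=; last first.
      by rewrite in_fset_set//; apply/mem_set; exists w.
    rewrite indicE mem_set// scale1r big1_fset ?addr0// => x.
    rewrite !inE => /andP[xs _] _; rewrite indicE memNset ?scale0r//= => sx.
    by rewrite sx eqxx in xs.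
  rewrite {}sE; elim: (enum_fset _) => [|x r [Is mS Ps]].
    (* No clause of the induction mentions the zero function; it is obtained as an indicator with
       coefficient 0. *)
    under eq_fun do rewrite big_nil.
    have [|] := Pindic set0 0; first by case: Gs.
    by under eq_fun do rewrite scaler0.
  under eq_fun do rewrite big_cons.
  have [Ix mx Px] := Pindic _ x (ms x).
  by split; [exact: L1D|exact: smeasD|exact: PD].
apply: Plim => // e e0; have [s [ss sf]] := bnorm_approx Gs Gm mf If.
have : \forall n \near \oo, (bnorm mu setT (fun w => f w - s n w)%R < e%:E)%E.
  apply: (sf [set x | (x < e%:E)%E]); apply: open_nbhs_nbhs.
  by split; [exact: open_ereal_lt_ereal|rewrite /= lte_fin].
move=> [N _ /(_ _ (leqnn N)) Ne]; exists (s N).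
by have [] := Psimple _ (ss N).
Qed.

End L1_induction.

Section completeness.
Context (d : measure_display) (T : measurableType d) (R : realType)
  (mu : {finite_measure set T -> \bar R}) (X : completeNormedModType R)
  (G : set (set T)).
Hypotheses (Gs : sigma_algebra setT G) (Gm : G `<=` measurable).
Hypothesis X_separable : separable X.
Local Notation L1 := (bochner_integrable mu).
Local Notation Gmeas := (strongly_measurable_wrt G).

(** The Riesz-Fischer argument: the sum [S] of the norms of the increments is integrable, so it is
    finite almost everywhere, and it dominates all errors. As [S] is [G]-measurable, the set [C]
    where it is finite lies in [G], and the limit extended by 0 outside [C] remains
    [G]-measurable. *)
Lemma L1_complete (g : nat -> T -> X) : (forall n, L1 (g n)) ->
  (forall n, Gmeas (g n)) ->
  (\sum_(n <oo) bnorm mu setT (fun w => g n.+1 w - g n w)%R < +oo)%E ->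
  exists h, [/\ L1 h, Gmeas h &
    bnorm mu setT (fun w => h w - g n w) @[n --> \oo] --> 0%E].
Proof.
move=> Ig mg sumg.
pose a n w := `|g n.+1 w - g n w|.
pose S w := (\sum_(n <oo) (a n w)%:E)%E.
have ma n : G.-mfun (fun w => (a n w)%:E).
  by apply/measurable_EFinP; apply: smeas_norm_mfun => //; exact: smeasB.
have a0 n w : (0 <= (a n w)%:E)%E by rewrite lee_fin /a.
have mGS : G.-mfun S.
  apply: (@ge0_emeasurable_sum _ (g_sigma_algebraType G) R setT
    (fun n w => (a n w)%:E) xpredT) => // k w _ _; exact: a0.
have mS : measurable_fun setT S by exact: mfun_sub mGS.
have S0 w : (0 <= S w)%E by apply: nneseries_ge0.
have IS : mu.-integrable setT S.
  apply/integrableP; split => //; under eq_integral do rewrite gee0_abs//.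
  rewrite integral_nneseries// => n; exact: mfun_sub (ma n).
pose C := [set w | (S w < +oo)%E].
have GC : G C.
  apply: (gset_mem Gs (u := fun w => (S w < +oo)%E)).
  apply: measurable_fun_lte => //.
have Cae : {ae mu, forall w, C w}.
  apply: filterS (integrable_ae measurableT IS) => w /(_ I).
  by rewrite ge0_fin_numE.
have gC w : C w -> cvgn (g^~ w).
  move=> Cw.
  have : cvgn (series (telescope (g^~ w))).
    apply: normed_cvg; apply: nondecreasing_is_cvgn.
      by apply: (@nondecreasing_series _ _ xpredT 0) => n _ _; exact: normr_ge0.
    exists (fine (S w)) => _ [n _ <-]; rewrite -lee_fin fineK; last first.
      by rewrite ge0_fin_numE.
    rewrite -[X in X%:E]/(\sum_(0 <= k < n) a k w) -sumEFin.
    apply: (@nneseries_lim_ge _ (fun k => (a k w)%:E) xpredT) => k _ _.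
    exact: a0.
  rewrite telescopeK => h.
  rewrite (_ : g^~ w = fun n => (g n w - g 0%N w) + g 0%N w).
    by apply: is_cvgD => //; exact: is_cvg_cst.
  by apply/funext => n; rewrite subrK.
pose h w := if w \in C then limn (g^~ w) else 0.
have gh w : C w -> g n w @[n --> \oo] --> h w.
  by move=> Cw; rewrite /h mem_set//; exact: gC.
have mh : Gmeas h.
  apply: (@smeas_lim _ _ _ Gs _ (fun n w => if w \in C then g n w else 0)) => //.
    by move=> n; apply: smeas_if => //; exact: smeas_cst.
  move=> w; rewrite /h; case: ifPn => [/set_mem/gC//|_]; exact: cvg_cst.
have gmn w n m : (n <= m)%N -> (`|g m w - g n w|%:E <= S w)%E.
  move=> nm; apply: (@le_trans _ _ (\sum_(n <= k < m) a k w)%:E).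
    rewrite lee_fin -(telescope_sumr (g^~ w))//; exact: ler_norm_sum.
  rewrite -sumEFin; apply: le_trans (nneseries_lim_ge m _) => //.
  rewrite [leRHS](@big_cat_nat _ _ _ n)//= leeDr//; exact: sume_ge0.
have hg w n : C w -> (`|h w - g n w|%:E <= S w)%E.
  move=> Cw; rewrite -(fineK (_ : S w \is a fin_num)) ?ge0_fin_numE// lee_fin.
  have : `|g m w - g n w| @[m --> \oo] --> `|h w - g n w|.
    by apply: cvg_norm; apply: cvgB; [exact: gh|exact: cvg_cst].
  move=> cv; rewrite -(cvg_lim _ cv)//; apply: limr_le.
    by apply/cvg_ex; eexists; exact: cv.
  near=> m; rewrite -lee_fin fineK ?ge0_fin_numE//; apply: gmn.
  by near: m; exact: nbhs_infty_ge.
have mhg n : Gmeas (fun w => h w - g n w) by exact: smeasB.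
have mhn n : measurable_fun setT (fun w => `|h w - g n w|%:E).
  exact/smeas_measurable_norm/(smeas_sub Gm).
have [|||_ h0 _] := @dominated_convergence _ _ _ mu setT measurableT
  (fun n w => `|h w - g n w|%:E) (cst 0%E) S mhn _ _ IS.
- exact: measurable_cst.
- apply: filterS Cae => w Cw _; apply: cvg_EFin; first by near=> n.
  have : `|h w - g n w| @[n --> \oo] --> `|h w - h w|.
    by apply: cvg_norm; apply: cvgB; [exact: cvg_cst|exact: gh].
  by rewrite subrr normr0.
- by apply: filterS Cae => w Cw n _; rewrite gee0_abs ?lee_fin//; exact: hg.
have cv : bnorm mu setT (fun w => h w - g n w) @[n --> \oo] --> 0%E.
  rewrite (_ : (fun n => _) = fun n =>
      (\int[mu]_w `| `|h w - g n w|%R%:E - cst 0 w|)%E); first exact: h0.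
  apply/funext => n; apply: eq_integral => w _.
  by rewrite /= subr0 normr_id.
exists h; split => //; apply: (@L1_leD _ _ _ _ _ (fun w => h w - g 0%N w) (g 0%N)).
- split; first exact: smeas_sub (mhg 0%N).
  apply: le_lt_trans (integrable_lty measurableT IS).
  apply: ae_ge0_le_integral => //.
  by apply: filterS Cae => w Cw _; exact: hg.
- exact: Ig.
- exact: smeas_sub mh.
- by move=> w; rewrite -{1}(subrK (g 0%N w) (h w)); exact: ler_normD.
Unshelve. all: by end_near. Qed.

End completeness.

(** * Existence of conditional expectations *)

Section trim.
Context (d : measure_display) (T : measurableType d) (R : realType)
  (mu : {finite_measure set T -> \bar R}) (G : set (set T)).

(** The restriction of [mu] to [G]. The two proofs are carried in the term so that its measure
    structure can be inferred. *)
Definition trim of sigma_algebra setT G & G `<=` measurable :=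
  fun A : set (g_sigma_algebraType G) => mu A.

Hypotheses (Gs : sigma_algebra setT G) (Gm : G `<=` measurable).

Lemma sub_measurable (A : set (g_sigma_algebraType G)) :
  (G.-sigma).-measurable A -> d.-measurable (A : set T).
Proof. by rewrite -(gsetE Gs); exact: Gm. Qed.

Let trim0 : trim Gs Gm set0 = 0%E. Proof. exact: measure0. Qed.

Let trim_ge0 A : (0 <= trim Gs Gm A)%E. Proof. exact: measure_ge0. Qed.

Let trim_sigma_additive : semi_sigma_additive (trim Gs Gm).
Proof.
move=> F mF tF mUF; apply: (@measure_semi_sigma_additive _ _ _ mu F) => //.
  by move=> n; exact: sub_measurable.
exact: sub_measurable.
Qed.

HB.instance Definition _ := isMeasure.Build _ (g_sigma_algebraType G) R
  (trim Gs Gm) trim0 trim_ge0 trim_sigma_additive.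

Let trim_fin_num : fin_num_fun (trim Gs Gm).
Proof. by move=> A mA; apply: fin_num_measure; exact: sub_measurable. Qed.

HB.instance Definition _ := @Measure_isFinite.Build _ (g_sigma_algebraType G) R
  (trim Gs Gm) trim_fin_num.

(** The restriction is the push-forward of [mu] under the identity onto the coarser measurable
    space. *)
Lemma ge0_integral_trim (B : set T) (f : T -> \bar R) : G B ->
  measurable_fun (T := g_sigma_algebraType G) setT f ->
  (forall w, 0 <= f w)%E ->
  (\int[trim Gs Gm]_(w in (B : set (g_sigma_algebraType G))) f w =
   \int[mu]_(w in B) f w)%E.
Proof.
move=> GB mf f0.
have mid : measurable_fun (T := T) (U := g_sigma_algebraType G) setT id.
  by move=> _ A mA; rewrite setTI; exact: sub_measurable.
have mB : (G.-sigma).-measurable (B : set (g_sigma_algebraType G)) by rewrite -(gsetE Gs).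
exact: (@ge0_integral_pushforward _ _ T (g_sigma_algebraType G) R id mid mu B f
  mB (measurable_funTS mf) (fun w _ => f0 w)).
Qed.

Lemma trim_integrable (f : T -> \bar R) :
  (trim Gs Gm).-integrable setT f -> mu.-integrable setT f.
Proof.
move=> /integrableP[mf If]; apply/integrableP; split; first exact: mfun_sub mf.
rewrite -(ge0_integral_trim (f := fun w => `|f w|%E))//.
- by rewrite (gsetE Gs).
- exact: measurableT_comp.
Qed.

Lemma integral_trim (B : set T) (f : T -> \bar R) : G B ->
  (trim Gs Gm).-integrable setT f ->
  (\int[trim Gs Gm]_(w in (B : set (g_sigma_algebraType G))) f w =
   \int[mu]_(w in B) f w)%E.
Proof.
move=> GB If.
have mid : measurable_fun (T := T) (U := g_sigma_algebraType G) setT id.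
  by move=> _ A mA; rewrite setTI; exact: sub_measurable.
have mB : (G.-sigma).-measurable (B : set (g_sigma_algebraType G)) by rewrite -(gsetE Gs).
apply: (@integral_pushforward _ _ T (g_sigma_algebraType G) R id mid mu B f) => //.
  exact: measurable_int If.
by apply: integrableS (trim_integrable If) => //; exact: Gm.
Qed.

End trim.

Section existence.
Context (d : measure_display) (T : measurableType d) (R : realType)
  (mu : {finite_measure set T -> \bar R}) (G : set (set T)).
Hypotheses (Gs : sigma_algebra setT G) (Gm : G `<=` measurable).

(** [p] is the conditional probability of [A] given [G]: the density, on [G], of the measure sending
    [B] to [mu (B]&[A)] with respect to [mu]. *)
Lemma indic_cond_exp (A : set T) : measurable A -> exists p : T -> R,
  [/\ G.-mfun p, mu.-integrable setT (EFin \o p) &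
    forall B, G B -> (\int[mu]_(w in B) (p w)%:E = mu (B `&` A))%E].
Proof.
move=> mA.
have Aoo : (mu A < +oo)%E by rewrite ltey_eq fin_num_measure.
pose muG : {finite_measure set (g_sigma_algebraType G) -> \bar R} := trim mu Gs Gm.
pose nu : {finite_measure set (g_sigma_algebraType G) -> \bar R} :=
  trim (mfrestr mA Aoo) Gs Gm.
have dom : charge_of_finite_measure nu `<< muG.
  move=> N N0 B mB BN; apply/eqP; rewrite eq_le measure_ge0 andbT.
  have mB' := sub_measurable Gs Gm mB.
  rewrite -(N0 B mB BN); apply: (@le_measure _ _ _ mu); rewrite ?in_setE//.
  exact: measurableI.
have If := Radon_Nikodym_integrable dom.
pose f := Radon_Nikodym (charge_of_finite_measure nu) muG.
have fE : f = EFin \o (fine \o f).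
  by apply/funext => w /=; rewrite fineK// Radon_Nikodym_fin_num.
have Ifm : mu.-integrable setT f by exact: trim_integrable If.
exists (fine \o f); split.
- apply/measurable_EFinP; rewrite -fE; exact: measurable_int If.
- by rewrite -fE.
move=> B GB.
have mB : (G.-sigma).-measurable (B : set (g_sigma_algebraType G)) by rewrite -(gsetE Gs).
have := Radon_Nikodym_integral dom mB.
rewrite (integral_trim GB If) -/f => RN; apply: etrans (esym RN).
by rewrite [in RHS]fE.
Qed.

Context (X : completeNormedModType R)
  (I : Type) (ell : I -> {linear X -> R^o}).
Hypothesis ellN : norming_family ell.
Hypothesis X_separable : separable X.
Local Notation L1 := (bochner_integrable mu).
Local Notation Gmeas := (strongly_measurable_wrt G).

Lemma scalar_cond_exp_indic A (c : X) : measurable A ->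
  exists g, [/\ L1 g, Gmeas g &
    scalar_cond_exp mu ell G (fun w => (\1_A w : R) *: c) g].
Proof.
move=> mA; have [p [mp Ip pE]] := indic_cond_exp mA.
have mpc : Gmeas (fun w => p w *: c).
  by apply: (smeasZ Gs (f := p)); exact: (mfun_smeas Gs mp).
exists (fun w => p w *: c); split => //.
  split; first exact: smeas_sub mpc.
  under eq_integral do rewrite normrZ mulrC EFinM.
  rewrite ge0_integralZl_EFin//; last first.
    apply/measurable_EFinP; apply: measurableT_comp => //.
    by apply/measurable_EFinP; exact: measurable_int Ip.
  have /integrableP[_ Ip'] := Ip.
  by apply: lte_mul_pinfty => //; rewrite lee_fin.
move=> B i GB; have mB := Gm GB.
transitivity ((ell i c)%:E * mu (B `&` A))%E.
  rewrite -pE// -integralZl//; last exact: integrableS Ip.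
  by apply: eq_integral => w _; rewrite linearZ/= EFinM muleC.
rewrite setIC -integral_indic// -integralZl//; last first.
  by apply: (integrableS measurableT) => //; exact: integrable_indic.
by apply: eq_integral => w _; rewrite linearZ/= EFinM muleC.
Qed.

Lemma scalar_cond_exp_exists f : L1 f ->
  exists g, [/\ L1 g, Gmeas g & scalar_cond_exp mu ell G f g].
Proof.
move=> If; have sT := sigma_algebra_measurable T.
apply: (L1_ind (mu := mu) sT _ (P := fun f => exists g,
  [/\ L1 g, Gmeas g & scalar_cond_exp mu ell G f g])) (L1_smeas If) => //.
- by move=> A c mA; exact: scalar_cond_exp_indic.
- move=> f1 f2 If1 If2 _ _ [g1 [Ig1 mg1 fg1]] [g2 [Ig2 mg2 fg2]].
  exists (fun w => g1 w + g2 w); split; first exact: L1D.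
    exact: smeasD.
  exact: scalar_cond_expD.
move=> {If}f If mf approx.
(* Geometric errors make the increments of the conditional expectations summable: contractivity
   bounds them by [e n.+1 + e n], hence by [2 / 2 ^ n.+1], with sum at most 2. *)
pose e n : R := 1 / (2 ^ n.+1)%:R.
have e0 n : 0 < e n by rewrite divr_gt0// ltr0n expn_gt0.
have /choice[fs] : forall n, exists fn, [/\ L1 fn,
    (bnorm mu setT (fun w => f w - fn w)%R < (e n)%:E)%E &
    exists g, [/\ L1 g, Gmeas g & scalar_cond_exp mu ell G fn g]].
  by move=> n; have [fn [? ? ? ?]] := approx _ (e0 n); exists fn.
move=> /all_and3[Ifs ffs /choice[g /all_and3[Ig mg fg]]].
have gdist n : (bnorm mu setT (fun w => g n.+1 w - g n w)%R <= (e n.+1 + e n)%:E)%E.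
  apply: le_trans (cond_exp_L1 ellN X_separable Gs Gm _ _ _
    (scalar_cond_expB ellN Gm _ _ _ _ (fg n.+1) (fg n))) _ => //.
  - exact: L1B.
  - exact: L1B.
  - exact: smeasB.
  rewrite EFinD; apply: le_trans (leeD (ltW (ffs n.+1)) (ltW (ffs n))).
  apply: le_bnormD => //; [exact: (L1_smeas (L1B If (Ifs _)))..| |].
    exact: (L1_smeas (L1B (Ifs _) (Ifs _))).
  move=> w _; rewrite (_ : fs n.+1 w - fs n w = (f w - fs n w) - (f w - fs n.+1 w)).
    by rewrite (le_trans (ler_normB _ _))// addrC.
  by rewrite opprB [RHS]addrC addrA subrK.
have [h [Ih mh gh]] : exists h, [/\ L1 h, Gmeas h &
    bnorm mu setT (fun w => h w - g n w) @[n --> \oo] --> 0%E].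
  apply: L1_complete => //.
  apply: (@le_lt_trans _ _ 2%:E); last exact: ltry.
  apply: (@le_trans _ _ (\sum_(n <oo) (2 / (2 ^ n.+1)%:R)%:E)%E).
    apply: lee_nneseries => n _; first by move=> _; exact: bnorm_ge0.
    apply: le_trans (gdist n) _; rewrite lee_fin /e.
    have -> : 2 / (2 ^ n.+1)%:R = 1 / (2 ^ n.+1)%:R + 1 / (2 ^ n.+1)%:R :> R by lra.
    rewrite lerD2r ler_pM2l// lef_pV2 ?posrE ?ltr0n ?expn_gt0// ler_nat.
    by rewrite leq_exp2l.
  exact: epsilon_trick0.
exists h; split=> // B i GB; have mB := Gm GB.
have fh := ell_integral_fin_num ellN i mB Ih.
have ff := ell_integral_fin_num ellN i mB If.
rewrite -(fineK fh) -(fineK ff); congr EFin.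
set a := fine _; set b := fine _.
suff : (fun=> a : R^o) n @[n --> \oo] --> (b : R^o).
  by move=> ab; apply: (cvg_unique (@norm_hausdorff R R^o) (cvg_cst a) ab).
have e_cvg : (bnorm mu setT (fun w => h w - g n w)%R + (e n)%:E)%E @[n --> \oo] --> 0%E.
  rewrite -[X in _ --> X]adde0; apply: cvgeD => //.
  apply: cvg_EFin; first by near=> n.
  apply: (squeeze_cvgr _ (cvg_cst 0) (@cvg_harmonic R)); near=> n.
  rewrite ltW//= /e div1r lef_pV2 ?posrE ?ltr0n ?expn_gt0// ler_nat.
  exact/ltnW/ltn_expl.
apply: (cvg_bnd (X := R^o)) e_cvg => n; rewrite -abse_EFin EFinB /a /b !fineK//.
have gfn := fg n B i GB.
(* On [B] the integrals of [g n] and of [fs n] agree against [ell i] and cancel, leaving two small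
   L_1 errors. *)
rewrite (_ : (_ - _ = (\int[mu]_(w in B) (ell i (f w - fs n w)%R)%:E) -
   (\int[mu]_(w in B) (ell i (h w - g n w)%R)%:E))%E); last first.
  rewrite !(ell_integralB ellN)// gfn.
  have := ell_integral_fin_num ellN i mB (Ifs n).
  move: fh ff => /fineK <- /fineK <- /fineK <-.
  by rewrite -!EFinB; congr EFin; rewrite opprB addrA subrK.
apply: le_trans (lee_abs_sub _ _) _; rewrite addeC; apply: leeD.
  apply: le_trans (ell_integral_le ellN _ _ _) _ => //; first exact: L1B.
  by apply: bnormT => //; exact: L1_smeas (L1B Ih (Ig n)).
apply: le_trans (ell_integral_le ellN _ _ _) _ => //; first exact: L1B.
apply: le_trans (ltW (ffs n)); apply: bnormT => //.
exact: L1_smeas (L1B If (Ifs n)).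
Unshelve. all: by end_near. Qed.

End existence.

(** * Density of the union of a filtration *)

(** [N] itself need not be measurable; the null cover is the intersection of the sets [Q n]. *)
Lemma small_negligible (d : measure_display) (T : measurableType d)
    (R : realType) (mu : {finite_measure set T -> \bar R}) (N : set T) :
  (forall e : R, 0 < e -> exists Q, [/\ measurable Q, N `<=` Q & (mu Q <= e%:E)%E]) ->
  mu.-negligible N.
Proof.
move=> small.
have /choice[Q /all_and3[mQ NQ Qn]] : forall n, exists Q,
    [/\ measurable Q, N `<=` Q & (mu Q <= (n.+1%:R^-1 : R)%:E)%E].
  by move=> n; apply: small; rewrite invr_gt0.
exists (\bigcap_n Q n); split.
- exact: bigcapT_measurable.
- apply/eqP; rewrite eq_le measure_ge0 andbT.
  apply/lee_addgt0Pr => e e0; rewrite add0e.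
  have [n ne] : exists n, n.+1%:R^-1 < e.
    by have [n] := ltr_add_invr e0; rewrite add0r; exists n.
  apply: le_trans (le_trans (Qn n) _); last by rewrite lee_fin ltW.
  apply: le_measure; rewrite ?in_setE//; first exact: bigcapT_measurable.
  by move=> w; exact.
- by move=> w Nw n _; exact: NQ.
Qed.

Section filtration.
Context (d : measure_display) (T : measurableType d) (R : realType)
  (mu : {finite_measure set T -> \bar R}) (F : R -> set (set T)).
Hypotheses (Fs : forall t, sigma_algebra setT (F t))
  (Fm : forall t, F t `<=` measurable)
  (Fle : forall s t, s <= t -> F s `<=` F t).
Implicit Types (A B : set T).

Let symdiff A B := (A `\` B) `|` (B `\` A).

(** The approximable sets form a sigma-algebra containing the generators. For a finite union the two
    times are replaced by their maximum, again in [K]; a countable union differs from a finite one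
    by a set of small measure, as [mu] is finite. *)
Lemma filtration_approx_set (K : set R) A : K !=set0 ->
  <<s \bigcup_(t in K) F t >> A -> forall e : R, 0 < e ->
  exists t B, [/\ K t, F t B & (mu (symdiff A B) < e%:E)%E].
Proof.
move=> [t0 Kt0].
pose P A := measurable A /\ forall e : R, 0 < e ->
  exists t B, [/\ K t, F t B & (mu (symdiff A B) < e%:E)%E].
have mF t B : F t B -> measurable B by exact: Fm.
have msd A' B : measurable A' -> measurable B -> measurable (symdiff A' B).
  by move=> mA mB; apply: measurableU; exact: measurableD.
have P0 : P set0.
  split=> // e e0; exists t0, set0; split => //; first by case: (Fs t0).
  by rewrite /symdiff setD0 setU0 measure0 lte_fin.
have PC A' : P A' -> P (setT `\` A').
  move=> [mA PA]; split=> [|e e0]; first exact: measurableD.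
  have [t [B [Kt FB AB]]] := PA e e0.
  exists t, (setT `\` B); split => //; first by case: (Fs t) => _ + _; exact.
  rewrite (_ : symdiff _ _ = symdiff A' B)//.
  by rewrite /symdiff !setTD setUC; congr (_ `|` _); rewrite !setDE setCK setIC.
have PU A1 A2 : P A1 -> P A2 -> P (A1 `|` A2).
  move=> [mA1 PA1] [mA2 PA2]; split=> [|e e0]; first exact: measurableU.
  have e2 : 0 < e / 2 by rewrite divr_gt0.
  have [t1 [B1 [Kt1 FB1 AB1]]] := PA1 _ e2.
  have [t2 [B2 [Kt2 FB2 AB2]]] := PA2 _ e2.
  exists (Num.max t1 t2), (B1 `|` B2); split.
  - by rewrite /Num.max; case: ifP.
  - have FB1' : F (Num.max t1 t2) B1 by apply: Fle FB1; rewrite le_max lexx.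
    have FB2' : F (Num.max t1 t2) B2 by apply: Fle FB2; rewrite le_max lexx orbT.
    move: FB1' FB2'; rewrite !(gsetE (Fs _)); exact: measurableU.
  - rewrite [e]splitr EFinD; apply: le_lt_trans (lteD AB1 AB2).
    have m1 : measurable (symdiff A1 B1) by apply: msd => //; exact: mF FB1.
    have m2 : measurable (symdiff A2 B2) by apply: msd => //; exact: mF FB2.
    apply: le_trans (measureU2 _ m1 m2); apply: le_measure; rewrite ?in_setE.
    + by apply: msd; apply: measurableU => //; [exact: mF FB1|exact: mF FB2].
    + exact: measurableU.
    + move=> w [] [[] wA /not_orP[]]; rewrite /symdiff /=; tauto.
have Pfin (A' : (set T)^nat) n : (forall k, P (A' k)) -> P (\big[setU/set0]_(k < n) A' k).
  move=> PA; elim: n => [|n IH]; first by rewrite big_ord0.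
  by rewrite big_ord_recr/=; exact: PU.
suff PH : <<s \bigcup_(t in K) F t >> `<=` P by move=> /PH[].
apply: smallest_sub.
- split=> // A' PA; have mA k : measurable (A' k) by case: (PA k).
  have mU : measurable (\bigcup_k A' k) by exact: bigcupT_measurable.
  split=> // e e0; have e2 : 0 < e / 2 by rewrite divr_gt0.
  pose U n := \big[setU/set0]_(k < n) A' k.
  have mUn n : measurable (U n) by exact: bigsetU_measurable.
  have : mu ((\bigcup_k A' k) `\` U n) @[n --> \oo] --> 0%E.
    rewrite -(measure0 mu) (_ : set0 = \bigcap_n ((\bigcup_k A' k) `\` U n)); last first.
      apply/seteqP; split=> // w wn; have [[k _ Ak] _] := wn 0%N I.
      have [_ []] := wn k.+1 I; rewrite /U -bigcup_mkord.
      by exists k => //=.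
    apply: nonincreasing_cvg_mu => //.
    - by rewrite ltey_eq fin_num_measure//; exact: measurableD.
    - by move=> n; exact: measurableD.
    - by apply: bigcapT_measurable => n; exact: measurableD.
    - move=> m n mn; apply/subsetPset => w [Uw nUw]; split=> // Umw; apply: nUw.
      exact: (subset_bigsetU mn).
  move=> cv.
  have : \forall n \near \oo, (mu ((\bigcup_k A' k) `\` U n) < (e / 2)%:E)%E.
    apply: (cv [set x | (x < (e / 2)%:E)%E]); apply: open_nbhs_nbhs.
    by split; [exact: open_ereal_lt_ereal|rewrite /= lte_fin].
  move=> [n _ /(_ n (leqnn n)) /= UUn].
  have [_ /(_ _ e2)[t [B [Kt FB AB]]]] := Pfin _ n PA.
  exists t, B; split=> //; rewrite [e]splitr EFinD; apply: le_lt_trans (lteD AB UUn).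
  have m1 : measurable (symdiff (U n) B) by apply: msd => //; exact: mF FB.
  have m2 : measurable ((\bigcup_k A' k) `\` U n) by exact: measurableD.
  apply: le_trans (measureU2 _ m1 m2); apply: le_measure; rewrite ?in_setE.
  + by apply: msd => //; exact: mF FB.
  + exact: measurableU.
  + move=> w [] [wA wB]; rewrite /symdiff/=.
      by have [|] := pselect (U n w); tauto.
    left; right; split=> // Uw; apply: wB.
    by move: Uw; rewrite /U -bigcup_mkord => -[k _ ?]; exists k.
- move=> B [t Kt FB]; split; first exact: mF FB.
  move=> e e0; exists t, B; split=> //.
  by rewrite /symdiff setDv setU0 measure0 lte_fin.
Qed.

Context (X : completeNormedModType R).
Local Notation L1 := (bochner_integrable mu).
Local Notation Gmeas := (strongly_measurable_wrt).

Lemma filtration_dense (K : set R) (u : T -> X) (e : R) : K !=set0 ->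
  <<s \bigcup_(t in K) F t >> `<=` measurable ->
  L1 u -> strongly_measurable_wrt <<s \bigcup_(t in K) F t >> u -> 0 < e ->
  exists t v, [/\ K t, L1 v, strongly_measurable_wrt (F t) v &
    (bnorm mu setT (fun w => u w - v w)%R < e%:E)%E].
Proof.
move=> K0 Hm Iu mu_ e0; move: e e0.
have Hs : sigma_algebra setT <<s \bigcup_(t in K) F t >>.
  exact: smallest_sigma_algebra.
apply: (L1_ind Hs Hm (P := fun u => forall e, 0 < e -> exists t v, [/\ K t, L1 v,
  strongly_measurable_wrt (F t) v &
  (bnorm mu setT (fun w => u w - v w)%R < e%:E)%E]) _ _ _ Iu mu_).
- move=> A c HA e e0.
  (* The added 1 allows division when [c = 0]. *)
  have c0 : 0 < `|c| + 1 by rewrite ltr_wpDl.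
  have [t [B [Kt FB AB]]] := filtration_approx_set K0 HA (divr_gt0 e0 c0).
  have mB := Fm FB; have mA := Hm _ HA.
  have mv : strongly_measurable_wrt (F t) (fun w => (\1_B w : R) *: c).
    exact: smeas_indic.
  exists t, (fun w => (\1_B w : R) *: c); split => //; first exact: L1_indic.
  have msd : measurable (symdiff A B) by apply: measurableU; exact: measurableD.
  rewrite (_ : bnorm _ _ _ = bnorm mu setT (fun w => (\1_(symdiff A B) w : R) *: c)).
    rewrite bnorm_cst_indic// setIT.
    have sdfin : mu (symdiff A B) \is a fin_num by exact: fin_num_measure.
    have sd0 : 0 <= fine (mu (symdiff A B)) by rewrite fine_ge0.
    move: AB; rewrite -(fineK sdfin) -EFinM !lte_fin ltr_pdivlMr//.
    by move=> /(le_lt_trans _); apply; rewrite mulrC ler_wpM2l// lerDl.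
  apply: eq_integral => w _; rewrite -scalerBl !normrZ; congr (_ * _)%:E.
  rewrite !indicE /symdiff.
  have [wA|wA] := pselect (A w); have [wB|wB] := pselect (B w);
    [rewrite (mem_set wA) (mem_set wB)|rewrite (mem_set wA) (memNset wB)|
     rewrite (memNset wA) (mem_set wB)|rewrite (memNset wA) (memNset wB)].
  - by rewrite memNset/= ?subrr//; tauto.
  - by rewrite mem_set/= ?subr0//; tauto.
  - by rewrite mem_set/= ?sub0r ?normrN//; tauto.
  - by rewrite memNset/= ?subrr//; tauto.
- move=> f g If Ig mf mg Pf Pg e e0.
  have e2 : 0 < e / 2 by rewrite divr_gt0.
  have [t1 [v1 [Kt1 Iv1 mv1 fv1]]] := Pf _ e2.
  have [t2 [v2 [Kt2 Iv2 mv2 gv2]]] := Pg _ e2.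
  exists (Num.max t1 t2), (fun w => v1 w + v2 w); split.
  + by rewrite /Num.max; case: ifP.
  + exact: L1D.
  + apply: smeasD => //.
      by apply: smeas_sub mv1; apply: Fle; rewrite le_max lexx.
    by apply: smeas_sub mv2; apply: Fle; rewrite le_max lexx orbT.
  + rewrite [e]splitr EFinD; apply: le_lt_trans (lteD fv1 gv2).
    apply: le_bnormD => //.
    * exact: L1_smeas (L1B If Iv1).
    * exact: L1_smeas (L1B Ig Iv2).
    * exact: L1_smeas (L1B (L1D If Ig) (L1D Iv1 Iv2)).
    * by move=> w _; rewrite opprD addrACA; exact: ler_normD.
- move=> f If mf approx e e0.
  have e2 : 0 < e / 2 by rewrite divr_gt0.
  have [g [Ig mg /(_ _ e2)[t [v [Kt Iv mv gv]]] fg]] := approx _ e2.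
  exists t, v; split=> //; rewrite [e]splitr EFinD; apply: le_lt_trans (lteD fg gv).
  apply: le_bnormD => //.
  * exact: L1_smeas (L1B If Ig).
  * exact: L1_smeas (L1B Ig Iv).
  * exact: L1_smeas (L1B If Iv).
  * by move=> w _; rewrite -[X in `|X|](subrKA (g w)); exact: ler_normD.
Qed.

End filtration.

(** * Doob's maximal inequality *)

Section maximal_inequality.
Context (d : measure_display) (T : measurableType d) (R : realType)
  (mu : {finite_measure set T -> \bar R}) (F : R -> set (set T)).
Hypotheses (Fs : forall t, sigma_algebra setT (F t))
  (Fm : forall t, F t `<=` measurable)
  (Fle : forall s t, s <= t -> F s `<=` F t).
Context (X : completeNormedModType R)
  (I : Type) (ell : I -> {linear X -> R^o}).
Hypothesis ellN : norming_family ell.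
Hypothesis X_separable : separable X.
Implicit Types (A B : set T).
Local Notation L1 := (bochner_integrable mu).

Lemma smeas_gt_set (G : set (set T)) (v : T -> X) (c : R) :
  sigma_algebra setT G -> strongly_measurable_wrt G v ->
  G [set w | c < `|v w|].
Proof.
move=> Gs mv; apply: gset_mem => //; apply: measurable_fun_ltr => //.
exact: smeas_norm_mfun.
Qed.

Lemma markov_bnorm B (v : T -> X) (c : R) : 0 <= c -> measurable B -> L1 v ->
  (c%:E * mu (B `&` [set w | (c < `|v w|)%R]) <=
   bnorm mu (B `&` [set w | (c < `|v w|)%R]) v)%E.
Proof.
move=> c0 mB Iv; set E := B `&` _.
have mE : measurable E.
  apply: measurableI => //; apply: smeas_gt_set (L1_smeas Iv).
  exact: sigma_algebra_measurable.
rewrite -(integral_cst mu mE); apply: ge0_le_integral => //.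
- exact: smeas_measurable_norm (L1_smeas Iv).
- by move=> w [_ cv]; rewrite lee_fin ltW.
Qed.

Section doob.
Variables (s0 c : R) (u : T -> X) (M : R -> T -> X).
Hypotheses (c0 : 0 < c) (Iu : L1 u).
Hypothesis HM : forall t, s0 <= t ->
  [/\ L1 (M t), strongly_measurable_wrt (F t) (M t) &
      scalar_cond_exp mu ell (F t) u (M t)].

Let exceed (r : seq R) := [set w | has (fun t => c < `|M t w|) r].

Let measurable_exceed r : all (>= s0) r -> measurable (exceed r).
Proof.
elim: r => [_|t r IH /= /andP[st sr]].
  by rewrite (_ : exceed _ = set0)//; apply/seteqP; split.
rewrite (_ : exceed _ = [set w | c < `|M t w|] `|` exceed r); last first.
  by apply/seteqP; split=> w /orP.
apply: measurableU; last exact: IH.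
have [/L1_smeas mM _ _] := HM st; apply: smeas_gt_set mM.
exact: sigma_algebra_measurable.
Qed.

(** Split [B] at the earliest time [t]. Where [M t] exceeds [c], Markov's inequality and
    contractivity conclude; the rest of [B] still belongs to [F t], hence to every later [F x], so
    the induction applies to it. This is why [B] is general. *)
Lemma doob_sorted (r : seq R) B : all (>= s0) r -> sorted <=%R r ->
  measurable B -> (forall t, t \in r -> F t B) ->
  (c%:E * mu (B `&` exceed r) <= bnorm mu B u)%E.
Proof.
elim: r B => [|t r IH] B; rewrite /=.
  move=> _ _ mB _; rewrite (_ : exceed _ = set0); last by apply/seteqP; split.
  by rewrite setI0 measure0 mule0 bnorm_ge0.
move=> /andP[st sr] tr mB FB.
have tle : all (fun x => t <= x) r := order_path_min le_trans tr.
have [IM mM uM] := HM st.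
pose E := [set w | c < `|M t w|].
have FE : F t E by exact: smeas_gt_set.
have FBt : F t B by apply: FB; rewrite mem_head.
have FBE : F t (B `&` E).
  by rewrite gsetE//; apply: measurableI; rewrite -gsetE.
have FBD : F t (B `\` E).
  by rewrite gsetE//; apply: measurableD; rewrite -gsetE.
have mBE : measurable (B `&` E) := Fm FBE.
have mBD : measurable (B `\` E) := Fm FBD.
have mX : measurable (exceed r) by exact: measurable_exceed.
have h1 : (c%:E * mu (B `&` E) <= bnorm mu (B `&` E) u)%E.
  apply: le_trans (markov_bnorm (ltW c0) mB IM) _.
  exact: (cond_exp_contraction ellN X_separable (Fs t) (Fm (t := t)) Iu IM mM uM FBE).
have h2 : (c%:E * mu ((B `\` E) `&` exceed r) <= bnorm mu (B `\` E) u)%E.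
  apply: IH => //; first exact: path_sorted tr.
  move=> x xr; apply: Fle FBD; exact: (allP tle).
have -> : bnorm mu B u = (bnorm mu (B `&` E) u + bnorm mu (B `\` E) u)%E.
  rewrite /bnorm -ge0_integral_setU//.
  - by rewrite setUIDK.
  - exact: smeas_measurable_norm (L1_smeas Iu).
  - by apply/disj_setPS => w [[_ ?] []].
apply: le_trans (leeD h1 h2); rewrite -ge0_muleDr ?measure_ge0//.
apply: lee_wpmul2l; first by rewrite lee_fin ltW.
apply: le_trans (measureU2 _ mBE _); last exact: measurableI.
apply: le_measure; rewrite ?in_setE.
- apply: measurableI => //.
  by apply: (@measurable_exceed (t :: r)); rewrite /= st.
- by apply: measurableU => //; exact: measurableI.
- move=> w [Bw /orP[Ew|rw]]; first by left.
  by have [Ew|Ew] := pselect (E w); [left|right].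
Qed.

Lemma doob_countable (D : set R) : countable D ->
  exists2 Q, measurable Q /\ (c%:E * mu Q <= bnorm mu setT u)%E &
    forall t w, D t -> s0 <= t -> c < `|M t w| -> Q w.
Proof.
move=> /countable_injP[i injI].
(* The default [s0] keeps every enumerated time in the range where [HM] applies. *)
pose e k := xget s0 [set x | [/\ D x, s0 <= x & i x = k]].
have e0 k : s0 <= e k by rewrite /e; case: xgetP => // x _ [].
have eD t : D t -> s0 <= t -> e (i t) = t.
  move=> Dt st; rewrite /e; case: xgetP => [x _ [Dx _ /injI]|/(_ t)].
    by apply; exact: mem_set.
  by case.
pose r n := [seq e k | k <- iota 0 n].
have rs0 n : all (>= s0) (r n) by apply/allP => _ /mapP[k _ ->].
(* The enumeration is in no particular order, whereas the finite inequality needs increasing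
   times. *)
have Er n : exceed (sort <=%R (r n)) = exceed (r n).
  by apply/seteqP; split=> w; rewrite /exceed /= (perm_has _ (permEl (perm_sort _ _))).
have bnd n : (c%:E * mu (exceed (r n)) <= bnorm mu setT u)%E.
  rewrite -Er -[X in mu X]setTI; apply: doob_sorted => //.
  - by rewrite all_sort.
  - exact: sort_le_sorted.
  - by move=> t _; rewrite gsetE.
have mr n : measurable (exceed (r n)) by exact: measurable_exceed.
exists (\bigcup_n exceed (r n)).
  have mU : measurable (\bigcup_n exceed (r n)) by exact: bigcupT_measurable.
  split=> //.
  have cv : (c%:E * mu (exceed (r n)))%E @[n --> \oo] -->
      (c%:E * mu (\bigcup_n exceed (r n)))%E.
    apply: cvgeZl => //; apply: nondecreasing_cvg_mu => //.
    move=> m n mn; apply/subsetPset => w /hasP[t /mapP[k]].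
    rewrite !mem_iota => km -> ck; apply/hasP; exists (e k) => //.
    apply: map_f; rewrite mem_iota.
    by case/andP: km => _ /leq_trans; apply; rewrite leq_add2l.
  rewrite -(cvg_lim _ cv)//; apply: lime_le; first by apply/cvg_ex; eexists; exact: cv.
  exact: nearW.
move=> t w Dt st cM; exists (i t).+1 => //=; apply/hasP; exists t => //.
by rewrite -[in X in X \in _](eD t)//; apply: map_f; rewrite mem_iota /= add0n ltnS.
Qed.

End doob.

Lemma martingale_cvg_countable (D : set R) (hinf : T -> X) (h : R -> T -> X) :
  let H := <<s \bigcup_(t in setT) F t >> in
  countable D -> L1 hinf -> strongly_measurable_wrt H hinf ->
  (forall t, [/\ L1 (h t), strongly_measurable_wrt (F t) (h t) &
     scalar_cond_exp mu ell (F t) hinf (h t)]) ->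
  {ae mu, forall w, forall e : R, 0 < e ->
    exists S, forall t, D t -> S <= t -> `|h t w - hinf w| <= e}.
Proof.
move=> H cD Iinf minf hh.
have Hm : H `<=` measurable.
  apply: smallest_sub; first exact: sigma_algebra_measurable.
  by move=> A [t _]; exact: Fm.
pose N (n : nat) := [set w | forall S, exists t, [/\ D t, S <= t &
  n.+1%:R^-1 < `|h t w - hinf w|]].
have Nneg n : mu.-negligible (N n).
  apply: small_negligible => e e0.
  (* Since [h t - hinf = M t - u], a deviation above [2 * c] forces [M t] or [u] above [c] in norm.
     Taking [v] within [c * (e / 2)] of [hinf] gives each of the two exceptional sets measure at
     most [e / 2]. *)
  pose c : R := n.+1%:R^-1 / 2.
  have c0 : 0 < c by rewrite divr_gt0// invr_gt0.
  have [s0 [v [_ Iv mv uv]]] := filtration_dense Fs Fm Fle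
    (ex_intro setT (0 : R) Logic.I) Hm Iinf minf (mulr_gt0 c0 (divr_gt0 e0 (ltr0n _ 2))).
  (* From time [s0] on, [v] is its own conditional expectation, so [M t] is that of [u]. *)
  pose u w := hinf w - v w; pose M t w := h t w - v w.
  have Iu : L1 u by exact: L1B.
  have HM t : s0 <= t -> [/\ L1 (M t), strongly_measurable_wrt (F t) (M t) &
      scalar_cond_exp mu ell (F t) u (M t)].
    move=> st; have [Ih mh hE] := hh t; split; first exact: L1B.
      by apply: smeasB => //; exact: smeas_sub (Fle st) mv.
    by apply: (scalar_cond_expB ellN (Fm (t := t))).
  have [Q1 [mQ1 Q1u] HQ1] := doob_countable c0 Iu HM cD.
  pose Q2 := setT `&` [set w | c < `|u w|].
  have mQ2 : measurable Q2.
    apply: measurableI => //; apply: smeas_gt_set (L1_smeas Iu).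
    exact: sigma_algebra_measurable.
  have Q2u : (c%:E * mu Q2 <= bnorm mu setT u)%E.
    apply: le_trans (markov_bnorm (ltW c0) measurableT Iu) _.
    exact: bnormT (L1_smeas Iu).
  exists (Q1 `|` Q2); split; first exact: measurableU.
    move=> w /(_ s0)[t [Dt st nh]].
    have [cM|cM] := ltP c `|M t w|; first by left; exact: HQ1 cM.
    right; split=> //=; rewrite ltNge; apply/negP => cu.
    move: nh; rewrite ltNge => /negP; apply.
    rewrite (_ : h t w - hinf w = M t w - u w).
      by apply: le_trans (ler_normB _ _) _; rewrite [leRHS]splitr lerD.
    by rewrite /M /u opprB addrA subrK.
  apply: le_trans (measureU2 _ mQ1 mQ2) _.
  have half Q : (c%:E * mu Q <= bnorm mu setT u)%E -> measurable Q ->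
      (mu Q <= (e / 2)%:E)%E.
    move=> cQ mQ; have Qfin : mu Q \is a fin_num by exact: fin_num_measure.
    have := le_trans cQ (ltW uv).
    by rewrite -(fineK Qfin) -EFinM !lee_fin ler_pM2l.
  by rewrite [e]splitr EFinD; apply: leeD; exact: half.
have : mu.-negligible (\bigcup_n N n) by exact: negligible_bigcup.
apply: negligibleS => w /= /existsNP[e /not_implyP[e0 noS]].
have [n] := ltr_add_invr e0; rewrite add0r => ne.
exists n => // S; have /existsNP[t /not_implyP[Dt /not_implyP[St ht]]] :
  ~ forall t, D t -> S <= t -> `|h t w - hinf w| <= e.
  by move=> hS; apply: noS; exists S.
exists t; split=> //; apply: lt_trans ne _.
by rewrite ltNge; apply/negP.
Qed.

End maximal_inequality.

(** * Left limits in L_1 *)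

Lemma dual_norming (R : realType) (X Y : normedModType R) : is_dual_of X Y ->
  exists ell : {y : Y | `|y| <= 1} -> {linear X -> R^o}, norming_family ell.
Proof.
move=> [J [Jc Jlin _ Jnorm]].
have Jl (y : Y) : linear (fun x => J x y : R^o) by move=> a x x'; exact: Jlin.
pose ell (y : {y : Y | `|y| <= 1}) : {linear X -> R^o} :=
  HB.pack (fun x => J x (val y) : R^o)
    (GRing.isLinear.Build R X R^o *:%R (fun x => J x (val y) : R^o) (Jl (val y))).
exists ell; split=> [[y y1] x|x c xc] /=.
  rewrite Jnorm; apply: ub_le_sup; last by exists y.
  (* [sup] is an upper bound only of a bounded set; boundedness comes from the continuity of
     [J x]. *)
  have /linear_bounded_continuous/bounded_funP/(_ 1)[M JM] := Jc x.
  by exists M => _ [z z1 <-]; exact: JM.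
rewrite Jnorm; apply: ge_sup.
  by exists `|J x 0|; exists 0 => //=; rewrite normr0.
by move=> _ [y y1 <-]; exact: (xc (exist _ y y1)).
Qed.

Section left_limits.
Context (d : measure_display) (T : measurableType d) (R : realType)
  (mu : {finite_measure set T -> \bar R}) (F : R -> set (set T)).
Hypotheses (Fs : forall t, sigma_algebra setT (F t))
  (Fm : forall t, F t `<=` measurable)
  (Fle : forall s t, s <= t -> F s `<=` F t).
Context (X : completeNormedModType R)
  (I : Type) (ell : I -> {linear X -> R^o}).
Hypothesis ellN : norming_family ell.
Hypothesis X_separable : separable X.
Local Notation L1 := (bochner_integrable mu).
Variables (f : T -> X) (h : R -> T -> X).
Hypothesis If : L1 f.
Hypothesis hP : forall t, [/\ L1 (h t), strongly_measurable_wrt (F t) (h t) &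
     scalar_cond_exp mu ell (F t) f (h t)].

(** For [t < s], [h t] is also the conditional expectation of [k], that of [f] given all times
    before [s]. If [v] is [F t0]-measurable and close to [k], contractivity keeps [h t] equally
    close to [v] for all [t] in [[t0, s[]. *)
Lemma martingale_left_cauchy (s e : R) : 0 < e ->
  exists2 t0, t0 < s & forall t t', t0 <= t < s -> t0 <= t' < s ->
    (bnorm mu setT (fun w => h t w - h t' w)%R < e%:E)%E.
Proof.
move=> e0; pose G := <<s \bigcup_(t in [set t | t < s]) F t >>.
have Gs : sigma_algebra setT G by exact: smallest_sigma_algebra.
have Gm : G `<=` measurable.
  apply: smallest_sub; first exact: sigma_algebra_measurable.
  by move=> A [t _]; exact: Fm.
have [k [Ik mk fk]] := scalar_cond_exp_exists Gs Gm ellN X_separable If.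
have S0 : [set t | t < s] !=set0 by exists (s - 1); rewrite /= ltrBlDr ltrDl.
have [t0 [v [t0s Iv mv kv]]] :=
  filtration_dense Fs Fm Fle S0 Gm Ik mk (divr_gt0 e0 (ltr0n _ 2)).
have hv t : t0 <= t < s -> (bnorm mu setT (fun w => h t w - v w)%R < (e / 2)%:E)%E.
  move=> /andP[tt0 ts]; have [It mt ht] := hP t; apply: le_lt_trans kv.
  apply: (cond_exp_L1 ellN X_separable (Fs t) (Fm (t := t))).
  - exact: L1B.
  - exact: L1B.
  - by apply: smeasB => //; exact: smeas_sub (Fle tt0) mv.
  - apply: (scalar_cond_expB ellN (Fm (t := t))) => // B i FB.
    rewrite ht// fk//; apply: sub_sigma_algebra; exists t => //.
exists t0 => // t t' tI t'I; rewrite [e]splitr EFinD.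
apply: le_lt_trans (lteD (hv _ tI) (hv _ t'I)).
have [[It _ _] [It' _ _]] := (hP t, hP t').
apply: le_bnormD => //.
- exact: L1_smeas (L1B It Iv).
- exact: L1_smeas (L1B It' Iv).
- exact: L1_smeas (L1B It It').
move=> w _; rewrite (_ : h t w - h t' w = (h t w - v w) - (h t' w - v w)).
  exact: ler_normB.
by rewrite opprB addrA subrK.
Qed.

(** Outside this set the [h q], for rational [q] in []s - 1, s[], come arbitrarily close to [h s] in
    L_1. They need not do so as [q] tends to [s]; the bounded window ensures that [q] tends to
    infinity with [s]. *)
Definition left_discontinuity : set R := [set s | exists n : nat, forall q : rat,
  s - 1 < ratr q < s ->
  (n.+1%:R^-1%:E <= bnorm mu setT (fun w => h s w - h (ratr q) w)%R)%E].

(** By the Cauchy property, each [s] has a rational [q s < s] with no point of [bad n] strictly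
    between. Two points of [bad n] sharing this rational would place the smaller one in the gap of
    the larger, so [q] is injective on [bad n]. *)
Lemma countable_left_discontinuity : countable left_discontinuity.
Proof.
pose bad n := [set s | forall q : rat, s - 1 < ratr q < s ->
  (n.+1%:R^-1%:E <= bnorm mu setT (fun w => h s w - h (ratr q) w)%R)%E].
rewrite (_ : left_discontinuity = \bigcup_n bad n); last first.
  by apply/seteqP; split=> s [n]; [move=> ?; exists n|move=> _ ?; exists n].
apply: bigcup_countable => // n _.
have gap s : exists q : rat, ratr q < s /\ forall t, ratr q < t < s -> ~ bad n t.
  have n0 : 0 < n.+1%:R^-1 :> R by rewrite invr_gt0.
  have [t0 t0s ht0] := martingale_left_cauchy s n0.
  have [q] := rat_in_itvoo t0s; rewrite in_itv/= => /andP[t0q qs].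
  exists q; split=> // t /andP[qt ts] /= bt.
  have t0t : Num.max t0 (t - 1) < t.
    by rewrite gt_max ltrBlDr ltrDl ltr01 andbT; exact: lt_trans qt.
  have [q'] := rat_in_itvoo t0t.
  rewrite in_itv/= gt_max => /andP[/andP[t0q' tq'] q't].
  have := bt q'; rewrite tq' q't => /(_ erefl); rewrite leNgt => /negP; apply.
  by apply: ht0; rewrite ?ts ?ltW//= ?(lt_trans q't)// (lt_trans t0q).
have [q qP] := choice gap.
apply/countable_injP; exists (choice.pickle \o q) => s t.
move=> /set_mem bs /set_mem bt /= /(pcan_inj choice.pickleK) qst.
have [st|st|//] := ltgtP s t; exfalso.
  have [_ /(_ s)] := qP t; rewrite -qst st.
  by have [-> _] := qP s; move=> /(_ erefl); exact.
have [_ /(_ t)] := qP s; rewrite qst st.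
by have [-> _] := qP t; move=> /(_ erefl); exact.
Qed.

End left_limits.

(** * Modification at the times of left continuity *)

Section modification.
Context (d : measure_display) (T : measurableType d) (R : realType)
  (mu : {finite_measure set T -> \bar R}) (X : completeNormedModType R)
  (I : Type) (ell : I -> {linear X -> R^o}).
Hypothesis ellN : norming_family ell.
Local Notation L1 := (bochner_integrable mu).

Lemma scalar_cond_exp_ae (G : set (set T)) (f h g : T -> X) :
  sigma_algebra setT G -> G `<=` measurable -> L1 h ->
  strongly_measurable_wrt G g -> {ae mu, forall w, g w = h w} ->
  scalar_cond_exp mu ell G f h -> L1 g /\ scalar_cond_exp mu ell G f g.
Proof.
move=> Gs Gm Ih mg gh fh; have mg' := smeas_sub Gm mg.
have Ig : L1 g.
  split=> //; have [mh Ih'] := Ih.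
  rewrite (ge0_ae_eq_integral (g := fun w => `|h w|%:E))//.
  - exact: smeas_measurable_norm.
  - exact: smeas_measurable_norm.
  - by apply: filterS gh => w -> .
split=> // B i GB; have mB := Gm _ GB; rewrite -fh//.
apply: ae_eq_integral => //.
- exact: (measurable_int _ (ell_integrable ellN i mB Ig)).
- exact: (measurable_int _ (ell_integrable ellN i mB Ih)).
- by apply: filterS gh => w -> .
Qed.

Context (F : R -> set (set T)).
Hypotheses (Fs : forall t, sigma_algebra setT (F t))
  (Fm : forall t, F t `<=` measurable)
  (Fle : forall s t, s <= t -> F s `<=` F t).
Context (h : R -> T -> X).
Hypothesis hP : forall t, L1 (h t) /\ strongly_measurable_wrt (F t) (h t).

(* Where h s is not a cluster value of the earlier h q, it is replaced by one
   of them: the exceptional set is F s-measurable and null. *)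
Lemma left_continuous_modification (s : R) :
  ~ left_discontinuity mu h s -> exists g : T -> X,
  [/\ strongly_measurable_wrt (F s) g, {ae mu, forall w, g w = h s w} &
      forall w (e : R), 0 < e -> exists q : rat,
        s - 1 < ratr q < s /\ `|g w - h (ratr q) w| < e].
Proof.
move=> cs.
have s1 : s - 1 < s by rewrite ltrBlDr ltrDl.
have [q0] := rat_in_itvoo s1; rewrite in_itv/= => q0s.
pose C n := \bigcup_(q in [set q : rat | s - 1 < ratr q < s])
  [set w | `|h s w - h (ratr q) w| < n.+1%:R^-1].
pose B := \bigcap_n C n.
have mhq (q : rat) : ratr q < s ->
    strongly_measurable_wrt (F s) (fun w => h s w - h (ratr q) w).
  move=> qs; apply: smeasB => //; first exact: (hP s).2.
  exact: smeas_sub (Fle (ltW qs)) (hP _).2.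
have FC n : F s (C n).
  rewrite gsetE// /C bigcup_mkcond; apply: bigcupT_measurable_rat => q.
  case: ifPn => [/set_mem/andP[_ qs]|_]; last exact: measurable0.
  rewrite -gsetE//; apply: gset_mem => //; apply: measurable_fun_ltr => //.
  by apply: smeas_norm_mfun => //; exact: mhq.
have FB : F s B.
  by rewrite gsetE//; apply: bigcapT_measurable => n; rewrite -gsetE.
pose g w := if w \in B then h s w else h (ratr q0) w.
exists g; split.
- apply: smeas_if => //; first exact: (hP s).2.
  by case/andP: q0s => _ qs; exact: smeas_sub (Fle (ltW qs)) (hP _).2.
- suff : mu.-negligible (~` B).
    apply: negligibleS => w /= gh Bw; apply: gh.
    by rewrite /g mem_set.
  rewrite setC_bigcap; apply: negligible_bigcup => n.
  apply: small_negligible => e e0.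
  (* Outside [C n] the distance is only at least [n.+1%:R^-1], while Markov's set asks for a strict
     excess; hence the smaller threshold. *)
  pose c : R := n.+2%:R^-1; have c0 : 0 < c by rewrite invr_gt0.
  have [k ke] := ltr_add_invr (mulr_gt0 c0 e0); rewrite add0r in ke.
  have [q [qs hq]] : exists q : rat, s - 1 < ratr q < s /\
      (bnorm mu setT (fun w => h s w - h (ratr q) w)%R < k.+1%:R^-1%:E)%E.
    apply: contrapT => nq; apply: cs; exists k => q qs.
    by rewrite leNgt; apply/negP => hq; apply: nq; exists q.
  have Iq : L1 (fun w => h s w - h (ratr q) w) := L1B (hP s).1 (hP _).1.
  have mk := markov_bnorm (ltW c0) measurableT Iq.
  pose Q := setT `&` [set w | c < `|h s w - h (ratr q) w|].
  have mQ : measurable Q.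
    apply: measurableI => //; apply: smeas_gt_set (L1_smeas Iq).
    exact: sigma_algebra_measurable.
  exists Q; split => //.
    move=> w Cw; split=> //=; rewrite ltNge; apply/negP => hc.
    apply: Cw; exists q => //=; apply: le_lt_trans hc _.
    by rewrite ltf_pV2 ?posrE// ltr_nat.
  have Qfin : mu Q \is a fin_num by exact: fin_num_measure.
  have := le_trans mk (le_trans (bnormT mu mQ (L1_smeas Iq)) (ltW hq)).
  rewrite -/Q -(fineK Qfin) -EFinM !lee_fin => h1.
  by rewrite -(ler_pM2l c0); apply: le_trans h1 (ltW ke).
- move=> w e e0; rewrite /g; case: ifPn => [/set_mem Bw|_]; last first.
    by exists q0; rewrite subrr normr0.
  have [n ne] := ltr_add_invr e0; rewrite add0r in ne.
  have [q qs hq] := Bw n Logic.I; exists q; split=> //.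
  exact: lt_trans ne.
Qed.

End modification.

(* The index set of (F s) is uncountable, so for arbitrary versions h s of
   E(f | F s) the pointwise limit over s in R need not exist anywhere.  The
   almost everywhere convergence is that of suitable representatives g s of
   the classes of the h s.  For a sequence (s_n) tending to +oo it yields
   h (s_n) --> hinf almost everywhere for the given versions themselves. *)
Theorem theorem2p4 (R : realType) (d : measure_display) (T : measurableType d)
    (mu : {finite_measure set T -> \bar R})
    (X Y : completeNormedModType R)
    (X_separable : separable X) (Y_separable : separable Y)
    (X_dual : is_dual_of X Y)
    (F : R -> set (set T))
    (F_sub : forall s, is_sub_sigma_algebra (F s))
    (F_incr : forall s1 s2 : R, s1 < s2 -> F s1 `<=` F s2)
    (Finf : set (set T))
    (F_gen : Finf = <<s \bigcup_(s in [set: R]) F s >>)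
    (f : T -> X) (f_L1 : bochner_integrable mu f) :
  [/\ (forall s, exists g : T -> X, is_cond_exp mu (F s) f g),
      (exists g : T -> X, is_cond_exp mu Finf f g)
    & forall (h : R -> T -> X) (hinf : T -> X),
        (forall s, is_cond_exp mu (F s) f (h s)) ->
        is_cond_exp mu Finf f hinf ->
        exists g : R -> T -> X,
          [/\ (forall s, is_cond_exp mu (F s) f (g s)),
              (forall s, {ae mu, forall w, g s w = h s w})
            & {ae mu, forall w, g s w @[s --> +oo] --> hinf w}]].
Proof.
have [ell ellN] := dual_norming X_dual.
have Fs t : sigma_algebra setT (F t) := (F_sub t).1.
have Fm t : F t `<=` measurable := (F_sub t).2.
have Fle s t : s <= t -> F s `<=` F t.
  by rewrite le_eqVlt => /predU1P[->//|]; exact: F_incr.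
have Hs : sigma_algebra setT Finf.
  by rewrite F_gen; exact: smallest_sigma_algebra.
have Hm : Finf `<=` measurable.
  rewrite F_gen; apply: smallest_sub; first exact: sigma_algebra_measurable.
  by move=> A [t _]; exact: Fm.
have FH t : F t `<=` Finf.
  by rewrite F_gen => A FA; apply: sub_sigma_algebra; exists t.
split.
- move=> s.
  have [g gP] := scalar_cond_exp_exists (Fs s) (Fm s) ellN X_separable f_L1.
  by exists g; apply/(is_cond_expP ellN g (Fm s) f_L1).
- have [g gP] := scalar_cond_exp_exists Hs Hm ellN X_separable f_L1.
  by exists g; apply/(is_cond_expP ellN g Hm f_L1).
move=> h hinf hE hinfE.
have hP t := (is_cond_expP ellN (h t) (Fm t) f_L1).1 (hE t).
have [hinf_L1 hinf_meas hinf_exp] := (is_cond_expP ellN hinf Hm f_L1).1 hinfE.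
have hP' t : bochner_integrable mu (h t) /\ strongly_measurable_wrt (F t) (h t).
  by have [] := hP t.
pose D : set R := range ratr `|` left_discontinuity mu h.
have cD : countable D.
  rewrite /D -bigcup2E; apply: bigcup_countable => // -[|[|n]] _ //=.
    by apply: sub_countable (countableP setT); exact: card_image_le.
  exact: (countable_left_discontinuity Fs Fm Fle ellN X_separable f_L1 hP).
(* For [s] in [D] the given version is kept and [q = s] is a witness, so both kinds of times satisfy
   one statement. *)
have /choice[g gP] : forall s, exists g : T -> X,
    [/\ strongly_measurable_wrt (F s) g, {ae mu, forall w, g w = h s w} &
     forall w (e : R), 0 < e -> exists q, [/\ D q, s - 1 < q &
       `|g w - h q w| < e]].
  move=> s; have [Ds|/not_orP[_ Ds]] := pselect (D s).
    exists (h s); split; [exact: (hP' s).2|exact: aeW|move=> w e e0].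
    by exists s; rewrite subrr normr0 ltrBlDr ltrDl.
  have [g [mg gh gq]] := left_continuous_modification Fs Fle hP' Ds.
  exists g; split=> // w e e0; have [q [/andP[sq _] gqe]] := gq w e e0.
  by exists (ratr q); split=> //; left; exists q.
exists g; split.
- move=> s; have [mg gh _] := gP s; have [Ih mh hs] := hP s.
  apply/(is_cond_expP ellN (g s) (Fm s) f_L1).
  by have [] := scalar_cond_exp_ae ellN (Fs s) (Fm s) Ih mg gh hs.
- by move=> s; have [] := gP s.
(* The tower property: [F t] is contained in [Finf], so the [h t] are also the conditional
   expectations of [hinf]. *)
have hM t : [/\ bochner_integrable mu (h t), strongly_measurable_wrt (F t) (h t)
    & scalar_cond_exp mu ell (F t) hinf (h t)].
  have [Ih mh hs] := hP t; split=> // B i FB.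
  by rewrite hs// hinf_exp//; exact: FH FB.
rewrite F_gen in hinf_meas.
apply: filterS (martingale_cvg_countable Fs Fm Fle ellN X_separable cD
  hinf_L1 hinf_meas hM) => w cvgD.
apply/cvgrPdist_lt => e e0; have e2 : 0 < e / 2 by rewrite divr_gt0.
have [S hS] := cvgD _ e2.
(* As [q > s - 1], taking [s] beyond [S + 1] puts [q] beyond [S]. *)
near=> s; have [q [Dq sq gq]] := (let: And3 _ _ H := gP s in H) w _ e2.
rewrite distrC -(subrKA (h q w)); apply: le_lt_trans (ler_normD _ _) _.
rewrite [e]splitr; apply: ltr_leD gq (hS _ Dq _).
apply: le_trans (ltW sq); rewrite lerBrDr; near: s.
by apply: nbhs_pinfty_ge; rewrite num_real.
Unshelve. all: by end_near. Qed.
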